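(* Let $d\geq 2$ and let $P$ be a polynomial in $d$ variables with complex coefficients, of degree $m$, such that $e_1$ is characteristic for $P$ while $e_d$ is not. Assume that $$P(x_1,\ldots,x_d)=\sum_{j=0}^m Q_j(x_1,\ldots,x_{d-1})\,x_d^j$$ with polynomials $Q_j$ in $d-1$ variables with complex coefficients such that $\deg_{x_1}(Q_k)<m-k$ for all $0\leq k\leq m-1$. Then, for every $a>0$ and every $\varepsilon\in(0,a)$ there is $u\in C^\infty(\mathbb{R}^d)$ with $P(D)u=0$ in $\mathbb{R}^d$ such that $$[-a,-\varepsilon]\times\mathbb{R}^{d-1}\subseteq\mathrm{supp}\,u\subseteq[-(a+\varepsilon),0]\times\mathbb{R}^{d-1}$$ and the restriction of $u$ to $(-a,-\varepsilon)\times\mathbb{R}^{d-1}$ is real analytic.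
   Context: $e_1,\dots,e_d$ is the standard basis of $\mathbb{R}^d$. For $P(x)=\sum_{|\alpha|\leq m}a_\alpha x^\alpha$ of degree $m$, the principal part is $P_m(x)=\sum_{|\alpha|=m}a_\alpha x^\alpha$, and $P(D)u=\sum_{|\alpha|\leq m}a_\alpha(-i)^{|\alpha|}\partial^\alpha u$. A vector $N\in\mathbb{R}^d\setminus\{0\}$ is characteristic for $P$ if $P_m(N)=0$. $\deg_{x_1}Q_k$ denotes the degree of $Q_k$ with respect to the variable $x_1$ (with $\deg_{x_1}0=-\infty$). *)

(* Defs.v *)
From HB Require Import structures.
From mathcomp Require Import all_boot all_order all_algebra.
(* To be imported before MathComp-Analysis: the opposite order is rejected
   because of conflicting notation levels. *)
From mathcomp.multinomials Require Import mpoly.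
From mathcomp Require Import all_classical all_reals all_analysis.
From mathcomp.analysis.showcase Require summability.
From mathcomp.real_closed Require Import complex.

Set Implicit Arguments.
Unset Strict Implicit.
Unset Printing Implicit Defensive.
Import Order.TTheory GRing.Theory Num.Theory.
Import numFieldNormedType.Exports.
Local Open Scope classical_set_scope.
Local Open Scope ring_scope.

Definition std_basis {R : realType} {n : nat} (i : 'I_n) : 'rV[R]_n :=
  delta_mx ord0 i.

Section Polynomials.
Context {R : realType} {n : nat}.
Implicit Types (p : {mpoly R[i][n]}) (N : 'rV[R]_n).

Definition principal_part p : {mpoly R[i][n]} :=
  pihomog mdeg (msize p).-1 p.

Definition characteristic p N : Prop :=
  N != 0 /\ (principal_part p).@[fun i => (N ord0 i)%:C%C] = 0.

(* The maximum over an empty support gives degree -oo to the polynomial 0. *)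
Definition degree_in (i : 'I_n) p : \bar int :=
  \big[Order.max/-oo%E]_(mu <- msupp p) (Posz (mu i))%:E.

End Polynomials.

Section Calculus.
Context {R : realType} {n : nat}.
Implicit Types (u : 'rV[R]_n.+1 -> R[i]) (i : 'I_n.+1).

Local Notation Re := (@complex.Re R).
Local Notation Im := (@complex.Im R).

(* R[i] is not a normed space over R in the libraries: derivatives and limits
   of complex-valued functions are taken on real and imaginary parts. *)
Definition cpartial i u : 'rV[R]_n.+1 -> R[i] := fun x =>
  ('D_(std_basis i) (Re \o u) x +i* 'D_(std_basis i) (Im \o u) x)%C.

Definition cpartial_seq (s : seq 'I_n.+1) u : 'rV[R]_n.+1 -> R[i] :=
  foldr cpartial u s.

(* Class C^oo: all iterated partial derivatives exist and are continuous. *)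
Definition smooth u : Prop := forall s : seq 'I_n.+1,
  [/\ continuous (Re \o cpartial_seq s u),
      continuous (Im \o cpartial_seq s u) &
      forall i x, derivable (Re \o cpartial_seq s u) x (std_basis i) /\
                  derivable (Im \o cpartial_seq s u) x (std_basis i)].

Definition cpartial_multi (mu : 'X_{1..n.+1}) u : 'rV[R]_n.+1 -> R[i] :=
  foldr (fun i => iter (mu i) (cpartial i)) u (enum 'I_n.+1).

Definition diff_op (p : {mpoly R[i][n.+1]}) u : 'rV[R]_n.+1 -> R[i] :=
  fun x => \sum_(mu <- msupp p)
    p@_mu * (- 'i%C) ^+ mdeg mu * cpartial_multi mu u x.

Definition supp u : set 'rV[R]_n.+1 := closure [set x | u x != 0].

(* Unconditional convergence, i.e., along the directed set of finite subsets of
   the index type; for complex series this is absolute convergence. *)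
Definition sums_to (I : choiceType) (f : I -> R[i]) (l : R[i]) : Prop :=
  (Re (summability.partial_sum f A) @[A --> summability.totally] --> Re l) /\
  (Im (summability.partial_sum f A) @[A --> summability.totally] --> Im l).

(* Only meant for open Omega, for which analyticity of the restriction of u to
   Omega can be tested on neighbourhoods in the whole space. *)
Definition real_analytic_on (Omega : set 'rV[R]_n.+1) u : Prop :=
  forall x0, Omega x0 -> exists c : 'X_{1..n.+1} -> R[i],
    \forall x \near x0,
      sums_to (fun mu : 'X_{1..n.+1} =>
        c mu * \prod_(i < n.+1) ((x - x0) ord0 i)%:C%C ^+ mu i) (u x).

End Calculus.

(* Main.v *)
Require Import Defs.
From HB Require Import structures.
From mathcomp Require Import all_boot all_order all_algebra.
From mathcomp.multinomials Require Import mpoly.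
From mathcomp Require Import all_classical all_reals all_analysis.
From mathcomp.real_closed Require Import complex.
From mathcomp Require Import finmap.
From mathcomp Require Import ring lra zify.

Set Implicit Arguments.
Unset Strict Implicit.
Unset Printing Implicit Defensive.
Import Order.TTheory GRing.Theory Num.Theory.
Import numFieldNormedType.Exports.
Local Open Scope classical_set_scope.
Local Open Scope ring_scope.

(** Take u depending on t = x_1 and s = x_d only.  On such functions P(D) acts
    as sum_(j <= m) q_j(d/dt) (d/ds)^j, where q_j collects the coefficients of
    the monomials x_1^l x_d^j of P, with the powers of -i absorbed.  Here q_m is
    a nonzero constant, because P has degree m and e_d is not characteristic,
    and deg q_j < m - j for j < m.  Hence the equation is a Cauchy problem in s,
    with the formal solution

      u(t, s) = sum_J (B_J(d/dt) f)(t) s^J / J!,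

    for polynomials B_J given by sum_(j <= m) q_j B_(J+j) = 0 and the initial
    B_0, ..., B_(m-1) (lemma [rec_solP]).

    Convergence: the strict inequality on the degrees gives
    deg B_J <= (m-1) J / m + O(1), with coefficients that grow geometrically
    in J ([subcritical_rec_sol]).  If f is Gevrey of order 1 + 1/m, then
    B_J(d/dt) f has size (J!)^((1 + 1/m) (m-1)/m) = (J!)^(1 - 1/m^2) up to
    geometric factors, and the division by J! makes the series, and all its
    derivatives, converge for all s, uniformly in t ([tame_jet_eval]).

    Support and analyticity: the Gevrey order is larger than 1, so f can be
    chosen with support in [-(a + eps), 0] and equal to 1 on [-a, -eps]
    ([gevrey_plateau]).  Then u vanishes wherever all the derivatives of f do.
    On the plateau only the constant coefficients B_J(0) are left.  With
    B_k = mu^k for k < m, where mu is a root of the polynomial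
    sum_j q_j(0) z^j, one gets B_J(0) = mu^J, so u = exp(mu s) there, which is
    analytic and has no zero ([sol_plateau], [cexp_neq0]).  The root exists
    because m > 0, which holds since e_1 is characteristic and e_d is not.

    A sequence of polynomials b = (b_J) encodes the function
    sol b = sum_J (b_J(d/dt) f)(t) s^J / J!.  Differentiation in t multiplies
    every b_J by X, differentiation in s shifts the sequence
    ([cpartial_sol]), and both preserve the growth condition above, so that
    smoothness and the equation P(D) u = 0 become statements on sequences of
    polynomials ([smooth_sol], [diff_op_sol]). *)

(** * Real calculus from derivative bounds *)

Section RealCalculus.
Context {R : realType}.
Implicit Types (f g : R -> R) (x : R).

(** The derivatives of series, and those of the flat function at 0, are obtained
    from remainder bounds of order two: such bounds, unlike derivatives, pass to
    limits of functions. *)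
Lemma is_derive_of_quadratic (V : normedModType R) (f : V -> R) (x v : V)
    (d C : R) :
  (forall h : R, `|h| <= 1 -> `|f (h *: v + x) - f x - h * d| <= C * h ^+ 2) ->
  is_derive x v f d.
Proof.
move=> H.
have C0 : 0 <= C.
  have := H 1; rewrite normr1 expr1n mulr1 => /(_ (lexx _)).
  exact: le_trans.
have cv : h^-1 *: ((f \o shift x) (h *: v) - f x) @[h --> (0 : R)^'] --> d.
  apply/cvgrPdist_le => e e0.
  have ee : 0 < Num.min 1 (e / (C + 1)).
    by rewrite lt_min ltr01 divr_gt0 // ltr_wpDl.
  near=> h.
  have h0 : h != 0 by near: h; exact: nbhs_dnbhs_neq.
  have : `|h| < Num.min 1 (e / (C + 1)) by near: h; exact: dnbhs0_lt.
  rewrite lt_min ltr_pdivlMr ?ltr_wpDl// => /andP[h1 he].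
  rewrite /= distrC.
  have -> : h^-1 *: (f (h *: v + x) - f x) - d
    = h^-1 * (f (h *: v + x) - f x - h * d).
    by rewrite mulrBr mulKf.
  rewrite normrM normfV ler_pdivrMl ?normr_gt0//.
  apply: (le_trans (H h (ltW h1))).
  rewrite -[h ^+ 2]real_normK ?num_real// expr2 mulrCA ler_pM2l ?normr_gt0//.
  by apply: le_trans (ltW he); rewrite mulrDr mulr1 mulrC lerDl.
apply: DeriveDef; first by apply/cvg_ex; exists d.
exact: cvg_lim.
Unshelve. all: by end_near. Qed.

Lemma is_derive_mul f g x df dg :
  is_derive x 1 f df -> is_derive x 1 g dg ->
  is_derive x 1 (fun y => f y * g y) (df * g x + f x * dg).
Proof.
move=> Hf Hg; have H := is_deriveM Hf Hg.
by apply: is_derive_eq; rewrite /GRing.scale /= addrC [in LHS](mulrC (g x)).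
Qed.

Lemma is_derive_scal f x c df :
  is_derive x 1 f df -> is_derive x 1 (fun y => c * f y) (c * df).
Proof.
by move=> Hf; apply: is_derive_eq (is_derive_mul (is_derive_cst _ _ _) Hf) _;
    rewrite mul0r add0r.
Qed.

Lemma is_derive_comp f g x df dg :
  is_derive (g x) 1 f df -> is_derive x 1 g dg ->
  is_derive x 1 (fun y => f (g y)) (df * dg).
Proof. exact: is_derive1_comp. Qed.

Lemma is_derive_sum_fun n (h : 'I_n -> R -> R) x (dh : 'I_n -> R) :
  (forall i, is_derive x 1 (h i) (dh i)) ->
  is_derive x 1 (fun y => \sum_(i < n) h i y) (\sum_(i < n) dh i).
Proof.
move=> H; rewrite (_ : (fun _ => _) = \sum_(i < n) h i);
    first exact: is_derive_sum.
by apply/funext => y; rewrite fct_sumE.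
Qed.

Lemma is_derive_continuous f x d : is_derive x 1 f d -> {for x, continuous f}.
Proof. by move=> H; apply: differentiable_continuous;
    apply/derivable1_diffP. Qed.

(** The endpoints come in either order, because increments of both signs are
    needed. *)
Lemma mvt f (df : R -> R) (x y : R) : (forall z : R, is_derive z 1 f (df z)) ->
    x != y ->
  exists2 z, Num.min x y < z < Num.max x y & f y - f x = df z * (y - x).
Proof.
move=> H.
have cf : continuous f by move=> z; exact: is_derive_continuous (H z).
wlog xy : x y / x < y => [hw|_].
  rewrite neq_lt => /orP[xy|xy]; first by apply: hw; rewrite ?lt_eqF.
  have [z] := hw _ _ xy (negbT (lt_eqF xy)).
  rewrite minC maxC => zz E; exists z => //.
  by rewrite -opprB E -mulrN opprB.
have [z zxy E] := MVT xy (fun z _ => H z) (continuous_subspaceT cf).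
by exists z => //; move: zxy; rewrite in_itv /= min_l ?max_r // ltW.
Qed.

Lemma lipschitz_of_derive f (df : R -> R) (x y C : R) :
  (forall z : R, is_derive z 1 f (df z)) ->
  (forall z, Num.min x y < z < Num.max x y -> `|df z| <= C) ->
  `|f y - f x| <= C * `|y - x|.
Proof.
move=> H HC; have [->|xy] := eqVneq x y; first by rewrite !subrr normr0 mulr0.
have [z zz ->] := mvt H xy.
by rewrite normrM ler_wpM2r // HC.
Qed.

Lemma const_of_derive0 f (s h : R) : (forall x : R, is_derive x 1 f 0) ->
    f s = f h.
Proof.
move=> H; apply/eqP; rewrite -subr_eq0 -normr_le0.
have := @lipschitz_of_derive f (fun=> 0) h s 0 H; rewrite mul0r; apply.
by move=> z _; rewrite normr0.
Qed.

(** The mean value inequality for f(y) - y f'(x), whose derivative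
    f'(y) - f'(x) is itself bounded by C |h| between x and x + h. *)
Lemma taylor2_of_derive f (df ddf : R -> R) (x h C : R) :
  (forall z : R, is_derive z 1 f (df z)) ->
      (forall z : R, is_derive z 1 df (ddf z)) ->
  (forall z, Num.min x (h + x) <= z <= Num.max x (h + x) -> `|ddf z| <= C) ->
  `|f (h + x) - f x - h * df x| <= C * h ^+ 2.
Proof.
move=> H1 H2 HC.
have H3 (z : R) : is_derive z 1 (fun y => f y + - df x * y) (df z - df x).
  have := is_deriveD (H1 z) (is_derive_scal (- df x) (is_derive_id z 1)).
  by rewrite mulr1.
have C0 : 0 <= C.
  by apply: le_trans (HC x _); rewrite // ge_min lexx le_max lexx.
have := @lipschitz_of_derive _ _ x (h + x) (C * `|h|) H3.
rewrite addrK -mulrA -expr2 real_normK ?num_real// => /(_ _)/wrap[].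
  move=> z /andP[z1 z2].
  have := @lipschitz_of_derive _ _ x z C H2.
  move=> /(_ _)/wrap[].
    move=> w /andP[w1 w2]; apply: HC.
    have m1 : Num.min x (h + x) <= x by rewrite ge_min lexx.
    have m2 : x <= Num.max x (h + x) by rewrite le_max lexx.
    apply/andP; split; apply: ltW.
      by apply: le_lt_trans w1; rewrite le_min m1 ltW.
    by apply: lt_le_trans w2 _; rewrite ge_max m2 ltW.
  move=> /le_trans; apply.
  rewrite ler_wpM2l //.
  move: z1 z2; rewrite /Num.min /Num.max.
  have := ler_norm h; have := ler_norm (- h); rewrite normrN => ? ?.
  by case: (ltP x (h + x)) => ? ? ?; rewrite ler_norml; apply/andP; split; lra.
by congr (`| _ | <= _); ring.
Qed.

End RealCalculus.

(** * A flat function of Gevrey order 1 + 1/p *)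

Section Gevrey.
Context {R : realType} (p : nat) (p_gt0 : (0 < p)%N).
Implicit Types (x y t : R).

(** The term t^n / n! of the exponential series is at most its sum. *)
Lemma exprn_le_fact_expR t n : 0 <= t -> t ^+ n <= n`!%:R * expR t.
Proof.
move=> t0; rewrite mulrC -ler_pdivrMr ?ltr0n ?fact_gt0//.
case: n => [|n]; last by apply: le_trans (expR_ge1Dxn n t0); rewrite lerDr.
by rewrite expr0 fact0 divr1; apply: le_trans (expR_ge1Dx _); rewrite lerDl.
Qed.

(** The k-th derivative of exp(-x^-p) on x > 0 is
    sum_j (gflat_coef k j) x^-(k + j p) exp(-x^-p): differentiating the
    exponential adds p + 1 to the power of 1/x, which is k -> k + 1, j -> j + 1,
    and differentiating the power adds 1, which is k -> k + 1 alone. *)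
Fixpoint gflat_coef k j : R :=
  if k is k'.+1 then
    (if j is j'.+1 then p%:R * gflat_coef k' j' else 0)
        - (k' + j * p)%:R * gflat_coef k' j
  else (j == 0%N)%:R.

(** The k-th derivative of the function equal to exp(-x^-p) for x > 0 and
    to 0 for x <= 0. *)
Definition gflat k x : R :=
  if 0 < x then
    (\sum_(j < k.+1) gflat_coef k j * x^-1 ^+ (k + j * p))
        * expR (- (x^-1 ^+ p))
  else 0.

Lemma gflat_coef_out k j : (k < j)%N -> gflat_coef k j = 0.
Proof.
elim: k j => [|k IH] [|j] //= kj.
by rewrite IH // IH 1?ltnW // !mulr0 subr0.
Qed.

(** The factor 1/j! matters: the term of index j carries (x^-p)^j, and
    (x^-p)^j / j! is absorbed by exp(x^-p / 2) at a geometric cost, so that only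
    the factor k! and the power x^-k are left in [gflat_le]. *)
Lemma gflat_coef_le k j :
  `|gflat_coef k j| <= (2 * p.+1)%:R ^+ k * k`!%:R / j`!%:R.
Proof.
elim: k j => [|k IH] j.
  case: j => [|j] /=; first by rewrite expr0 fact0 normr1 mul1r divr1.
  by rewrite normr0 expr0 mul1r divr_ge0.
have [kj|jk] := ltnP k.+1 j.
  by rewrite gflat_coef_out // normr0 !mulr_ge0 ?invr_ge0 ?exprn_ge0.
have h1 : `|if j is j'.+1 then p%:R * gflat_coef k j' else 0|
    <= (p * j)%:R * ((2 * p.+1)%:R ^+ k * k`!%:R / j`!%:R).
  case: j {jk} => [|j]; first by rewrite normr0 muln0 mul0r.
  rewrite normrM normr_nat.
  apply: le_trans (ler_wpM2l _ (IH j)) _ => //.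
  rewrite (natrM _ p) factS (natrM _ j.+1) -(mulrA p%:R) ler_wpM2l //.
  have jn : j.+1%:R != 0 :> R by rewrite pnatr_eq0.
  have fn : j`!%:R != 0 :> R by rewrite pnatr_eq0 -lt0n fact_gt0.
  rewrite le_eqVlt; apply/orP; left; apply/eqP.
  by move: (j.+1%:R : R) (j`!%:R : R) jn fn => a b jn fn; field; rewrite fn jn.
apply: le_trans (ler_normB _ _) _; rewrite normrM normr_nat.
apply: le_trans (lerD h1 (ler_wpM2l _ (IH j))) _ => //.
rewrite -mulrDl -natrD factS exprS (natrM _ k.+1).
rewrite [X in _ <= X](_ : _ = (2 * p.+1 * k.+1)%:R
    * ((2 * p.+1)%:R ^+ k * k`!%:R / j`!%:R)); last by rewrite !natrM; ring.
apply: ler_wpM2r; first by rewrite !mulr_ge0 ?invr_ge0 ?exprn_ge0.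
by rewrite ler_nat; move: jk p_gt0; nia.
Qed.

Lemma is_derive_invX (N : nat) x : 0 < x ->
  is_derive x 1 (fun z => z^-1 ^+ N) (- N%:R * x^-1 ^+ N.+1).
Proof.
move=> x0; have xn0 : x != 0 by rewrite gt_eqF.
have h1 := is_deriveV xn0 (is_derive_id x 1).
have h2 := is_deriveX N h1.
rewrite (_ : (fun _ => _) = GRing.inv ^+ N); last first.
  by apply/funext => z; rewrite exprfctE.
apply: is_derive_eq h2 _.
rewrite /GRing.scale /= mulr1.
case: N => [|N]; first by rewrite !mulr0n oppr0 !mul0r.
by rewrite [N.+1.-1]/= -exprVn !exprS; ring.
Qed.

Lemma is_derive_gflat_gt0 k x : 0 < x -> is_derive x 1 (gflat k) (gflat k.+1 x).
Proof.
move=> x0; have xn0 : x != 0 by rewrite gt_eqF.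
pose F z := (\sum_(j < k.+1) gflat_coef k j * z^-1 ^+ (k + j * p))
    * expR (- (z^-1 ^+ p)).
apply: (@near_eq_is_derive _ _ _ F).
  near=> z; rewrite /gflat ifT //.
  by near: z; exact: lt_nbhsr.
have h1 : is_derive x 1 (fun z =>
    \sum_(j < k.+1) gflat_coef k j * z^-1 ^+ (k + j * p))
   (\sum_(j < k.+1) gflat_coef k j
       * (- (k + j * p)%:R * x^-1 ^+ (k + j * p).+1)).
  apply: is_derive_sum_fun => i; apply: is_derive_scal; exact: is_derive_invX.
have h2 : is_derive x 1 (fun z => - (z^-1 ^+ p)) (- (- p%:R * x^-1 ^+ p.+1)).
  by apply: is_deriveN; exact: is_derive_invX.
have h3 := is_derive_comp (is_derive_expR _) h2.
apply: is_derive_eq (is_derive_mul h1 h3) _.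
rewrite /gflat x0.
rewrite [in RHS](eq_bigr (fun j : 'I_k.+2 =>
   (if (j : nat) is j'.+1 then p%:R * gflat_coef k j' else 0)
       * x^-1 ^+ (k.+1 + j * p)
  + - (k + j * p)%:R * gflat_coef k j * x^-1 ^+ (k.+1 + j * p))); last first.
  by move=> j _ /=; rewrite mulrDl mulNr.
rewrite [in RHS]big_split /= mulrDl addrC [in RHS]big_ord_recl
    [X in _ = _ + X * _]big_ord_recr /=.
rewrite mul0r add0r gflat_coef_out // mulr0 mul0r addr0.
congr (_ + _); last first.
  by congr (_ * _); apply: eq_bigr => j _; rewrite addSn; ring.
rewrite mulrCA [RHS]mulrC; congr (_ * _).
rewrite mulNr opprK.
rewrite mulr_suml; apply: eq_bigr => j _; rewrite /bump /= add1n add0n.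
rewrite (_ : k.+1 + j.+1 * p = (k + j * p) + p.+1)%N; last by nia.
by rewrite [in RHS]exprD mulrACA (mulrC (gflat_coef k j)).
Unshelve. all: by end_near. Qed.

Lemma exprn_expRN_le (N : nat) y : 0 <= y ->
    y ^+ N * expR (- (y ^+ p)) <= N`!%:R.
Proof.
move=> y0; have [y1|/ltW y1] := leP y 1.
  rewrite -[X in _ <= X]mulr1; apply: ler_pM; rewrite ?exprn_ge0 ?expR_ge0//.
    apply: le_trans (exprn_ile1 N y0 y1) _.
    by rewrite ler1n fact_gt0.
  by rewrite -expR0 ler_expR oppr_le0 exprn_ge0.
have h : y <= y ^+ p by rewrite -[X in X <= _]expr1 ler_weXn2l.
rewrite expRN ler_pdivrMr ?expR_gt0//.
apply: le_trans (exprn_le_fact_expR N y0) _.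
by rewrite ler_wpM2l // ler_expR.
Qed.

(** With y = 1/x this is the boundedness of y^N exp(-y^p) on y >= 0; it gives
    the derivatives at 0, all equal to 0. *)
Lemma gflat_quadratic k : exists C, forall x, `|gflat k x| <= C * x ^+ 2.
Proof.
exists (\sum_(j < k.+1) `|gflat_coef k j| * (k + j * p + 2)`!%:R) => x.
rewrite /gflat; case: ltP => [x0|_]; last first.
  rewrite normr0 mulr_ge0 ?sqr_ge0 ?sumr_ge0// => j _; exact: mulr_ge0.
rewrite mulr_suml; apply: le_trans (ler_norm_sum _ _ _) _.
rewrite mulr_suml; apply: ler_sum => j _.
rewrite -mulrA normrM -[X in _ <= X]mulrA ler_wpM2l //.
have := @exprn_expRN_le (k + j * p + 2) x^-1; rewrite invr_ge0 => /(_ (ltW x0)).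
move=> h; rewrite ger0_norm; last by rewrite mulr_ge0 ?expR_ge0 ?exprn_ge0
    ?invr_ge0 ?ltW.
rewrite -ler_pdivrMr ?exprn_gt0//; apply: le_trans h.
by rewrite le_eqVlt; apply/orP; left; apply/eqP;
    rewrite [in RHS]exprD -[x ^- 2]exprVn [RHS]mulrAC.
Qed.

Lemma is_derive_gflat k x : is_derive x 1 (gflat k) (gflat k.+1 x).
Proof.
have [x0|x0|<-] := ltgtP 0 x; first exact: is_derive_gflat_gt0.
- rewrite [gflat k.+1 x]/gflat ltNge ltW //=.
  apply: (@near_eq_is_derive _ _ _ (cst 0)).
  near=> z; rewrite /gflat ifF // ltNge ltW //.
  by near: z; exact: lt_nbhsl.
- have [C hC] := gflat_quadratic k.
  apply: (@is_derive_of_quadratic _ _ _ _ _ _ C) => h _.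
  have := hC h; rewrite /gflat ltxx !subr0 mulr0 subr0 addr0 /GRing.scale /=
      mulr1.
Unshelve. all: by end_near. Qed.

Lemma gflat_le0 k x : x <= 0 -> gflat k x = 0.
Proof. by rewrite /gflat ltNge => ->. Qed.

Lemma gflat0_gt0 x : 0 < x -> 0 < gflat 0 x.
Proof. by move=> x0; rewrite /gflat x0 big_ord1 /= mul1r mul1r expR_gt0. Qed.

(** Gevrey estimate of order 1 + 1/p, raised to the power p to avoid roots.
    With y = 1/x and t = y^p, the exponential exp(-t) is split in two halves:
    one absorbs the t^j / j!, the other absorbs y^k, whose p-th power is
    t^k <= 2^k k! exp(t/2), whence the additional factor (k!)^(1/p). *)
Lemma gflat_le k x :
  `|gflat k x| ^+ p <= ((8 * p.+1) ^ p * 2)%:R ^+ k * k`!%:R ^+ p.+1.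
Proof.
rewrite /gflat; case: ltP => [x0|_]; last first.
  by rewrite normr0 expr0n gtn_eqF// mulr_ge0 ?exprn_ge0.
set y := x^-1; have y0 : 0 <= y by rewrite invr_ge0 ltW.
set t := y ^+ p; have t0 : 0 <= t by rewrite exprn_ge0.
(* The square root of exp(-t). *)
set e := expR (- (t / 2)).
have e0 : 0 <= e by exact: expR_ge0.
have -> : expR (- t) = e * e by rewrite -expRD; congr expR; lra.
have te i : t ^+ i * e <= 2 ^+ i * i`!%:R.
  rewrite /e expRN ler_pdivrMr ?expR_gt0// -mulrA -ler_pdivrMl ?exprn_gt0//.
  rewrite mulrC -expr_div_n; apply: exprn_le_fact_expR; lra.
have b1 : `|(\sum_(j < k.+1) gflat_coef k j * y ^+ (k + j * p)) * (e * e)| <=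
   ((8 * p.+1)%:R ^+ k * k`!%:R) * (y ^+ k * e).
  rewrite mulr_suml; apply: le_trans (ler_norm_sum _ _ _) _.
  have b2 (j : 'I_k.+1) : `|gflat_coef k j * y ^+ (k + j * p) * (e * e)| <=
     (2 * p.+1)%:R ^+ k * k`!%:R * (y ^+ k * e) * 2 ^+ k.
    rewrite normrM normrM (ger0_norm (exprn_ge0 _ y0))
        (ger0_norm (mulr_ge0 e0 e0)).
    rewrite exprD (mulnC j) exprM -/t.
    have := gflat_coef_le k j => g1.
    have t1 : t ^+ j * e <= 2 ^+ k * j`!%:R.
      apply: le_trans (te j) _; rewrite ler_wpM2r// ler_weXn2l ?ler1n//.
      by rewrite -ltnS.
    rewrite (_ : _ * _ * _ = `|gflat_coef k j| * ((y ^+ k * e) * (t ^+ j * e)));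
        last by ring.
    apply: le_trans (ler_pM _ _ g1 (ler_wpM2l _ t1)) _;
        rewrite ?mulr_ge0 ?exprn_ge0//.
    have : j`!%:R != 0 :> R by rewrite pnatr_eq0 -lt0n fact_gt0.
    by move=> jn; rewrite le_eqVlt; apply/orP; left; apply/eqP; field.
  apply: le_trans (ler_sum _ (fun j _ => b2 j)) _.
  rewrite sumr_const card_ord -[X in X <= _]mulr_natr.
  rewrite [X in X <= _](_ : _ = (2 * p.+1)%:R ^+ k * k`!%:R * (y ^+ k * e)
      * (2 ^+ k * k.+1%:R)); last by ring.
  have : 2 ^+ k * k.+1%:R <= 2 ^+ k * 2 ^+ k :> R.
    by rewrite ler_wpM2l ?exprn_ge0// -natrX ler_nat ltn_expl.
  move=> /(ler_wpM2l _) h; apply: le_trans (h _ _) _;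
      first by rewrite !mulr_ge0 ?exprn_ge0.
  rewrite (_ : 8 * p.+1 = 2 * p.+1 * (2 * 2))%N; last by ring.
  by rewrite [(_ * (2 * 2))%:R]natrM [in X in _ <= X]exprMn (natrM _ 2 2)
      [(2 * 2) ^+ k]exprMn le_eqVlt; apply/orP; left; apply/eqP; ring.
apply: le_trans (_ : _ <= (((8 * p.+1)%:R ^+ k * k`!%:R) * (y ^+ k * e)) ^+ p)
    _.
  by rewrite lerXn2r ?nnegrE// !mulr_ge0 ?exprn_ge0.
rewrite exprMn [(y ^+ k * e) ^+ p]exprMn -exprM (mulnC k p) exprM -/t.
have ep : e ^+ p <= e.
  have e1 : e <= 1 by rewrite /e -[X in _ <= X]expR0 ler_expR; lra.
  by rewrite -[X in _ <= X]expr1; apply: ler_wiXn2l.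
have : t ^+ k * e ^+ p <= 2 ^+ k * k`!%:R.
  apply: le_trans (te k); rewrite ler_wpM2l ?exprn_ge0//.
move=> /(ler_wpM2l _) h; apply: le_trans (h _ _) _;
    first by rewrite exprn_ge0 // mulr_ge0 ?exprn_ge0.
move: (8 * p.+1)%N => A.
by rewrite natrM !exprMn natrX -!exprM (mulnC k p) [X in _ <= _ * X]exprSr
    mulrACA.
Qed.

End Gevrey.

(** * Gevrey plateau functions *)

Section Plateau.
Context {R : realType}.
Implicit Types (x y a e : R).

Lemma ler_root (p : nat) (x y : R) : (0 < p)%N -> 0 <= x -> 0 <= y ->
  (x ^+ p <= y ^+ p) = (x <= y).
Proof. by move=> p0 x0 y0; apply: ler_pXn2r. Qed.

Lemma exists_root (p : nat) (y : R) : (0 < p)%N -> 0 <= y ->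
  exists2 mu, 0 <= mu & mu ^+ p = y.
Proof.
move=> p0 y0; exists (y `^ p%:R^-1); first exact: powR_ge0.
rewrite -powR_mulrn ?powR_ge0// -powRrM mulVf ?powRr1//.
by rewrite pnatr_eq0 -lt0n.
Qed.

(** The k-th derivative of a product, for functions f 0 and g 0 given with
    their successive derivatives f i and g i. *)
Definition leibniz (f g : nat -> R -> R) k x :=
  \sum_(i < k.+1) 'C(k, i)%:R * (f i x * g (k - i)%N x).

Lemma is_derive_leibniz (f g : nat -> R -> R) k x :
  (forall i, is_derive x 1 (f i) (f i.+1 x)) ->
  (forall i, is_derive x 1 (g i) (g i.+1 x)) ->
  is_derive x 1 (leibniz f g k) (leibniz f g k.+1 x).
Proof.
move=> Hf Hg.
have H : is_derive x 1 (leibniz f g k)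
  (\sum_(i < k.+1) 'C(k, i)%:R * (f i.+1 x * g (k - i)%N x
      + f i x * g (k - i).+1 x)).
  apply: is_derive_sum_fun => i; apply: is_derive_scal; exact: is_derive_mul.
apply: is_derive_eq H _; rewrite /leibniz [in RHS]big_ord_recl /=.
under [in RHS]eq_bigr do rewrite /bump /= add1n binS natrD mulrDl subSS.
rewrite [in RHS]big_split /= addrA [RHS]addrC.
under eq_bigr do rewrite mulrDr.
rewrite big_split /=; congr (_ + _).
rewrite big_ord_recl [in RHS]big_ord_recr /=.
rewrite (@bin_small k k.+1) // mul0r addr0 !bin0 !subn0; congr (_ + _).
by apply: eq_bigr => i _; rewrite /bump /= add1n -subSn // ltnS ltnW.
Qed.

(** Gevrey bounds are stable under products: i! (k - i)! <= k!, and the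
    binomial coefficients sum to 2^k. *)
Lemma leibniz_le (p : nat) (D : R) (f g : nat -> R -> R) k x :
  (0 < p)%N -> 0 <= D ->
  (forall i, `|f i x| ^+ p <= D ^+ i * i`!%:R ^+ p.+1) ->
  (forall i, `|g i x| ^+ p <= D ^+ i * i`!%:R ^+ p.+1) ->
  `|leibniz f g k x| ^+ p <= (2 ^+ p * D) ^+ k * k`!%:R ^+ p.+1.
Proof.
move=> p0 D0 Hf Hg.
have [mu mu0 muE] : exists2 mu : R, 0 <= mu & mu ^+ p = D ^+ k * k`!%:R ^+ p.+1.
  by apply: exists_root => //; rewrite mulr_ge0 ?exprn_ge0.
have H : `|leibniz f g k x| <= 2 ^+ k * mu.
  apply: le_trans (ler_norm_sum _ _ _) _.
  have -> : 2 ^+ k = \sum_(i < k.+1) 'C(k, i)%:R :> R.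
    rewrite -natr_sum -natrX; congr _%:R.
    rewrite -[2%N]/(1 + 1)%N expnDn; apply: eq_bigr => i _.
    by rewrite !exp1n !muln1.
  rewrite mulr_suml; apply: ler_sum => i _.
  rewrite normrM normr_nat ler_wpM2l // -(ler_root p0) // muE normrM exprMn.
  apply: le_trans (ler_pM _ _ (Hf i) (Hg (k - i)%N)) _; rewrite ?exprn_ge0//.
  have ik : (i <= k)%N by rewrite -ltnS.
  rewrite mulrACA -exprD (subnKC ik) ler_wpM2l ?exprn_ge0// -exprMn.
  rewrite lerXn2r ?nnegrE// ?mulr_ge0// -natrM ler_nat.
  by rewrite -(bin_fact ik) leq_pmull // bin_gt0.
have := H; rewrite -(ler_root p0) ?mulr_ge0 ?exprn_ge0// => /le_trans; apply.
by rewrite exprMn muE exprMn mulrA -!exprM mulnC.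
Qed.

(** The integral from -1 is a primitive at all points, since to the left
    of 0 both it and b vanish. *)
Lemma exists_primitive (b : R -> R) : continuous b ->
  (forall x, x <= 0 -> b x = 0) ->
  exists F : R -> R, forall x, is_derive x 1 F (b x).
Proof.
move=> cb b0.
pose F x := \int[lebesgue_measure]_(t in `[(-1 : R), x]) b t.
exists F => x; have [x0|x0] := ltP x 0.
  rewrite b0 ?ltW//.
  apply: (@near_eq_is_derive _ _ _ (cst 0)).
  near=> z; rewrite /F /Rintegral integral0_eq // => t /=.
  rewrite in_itv /= => /andP[_ tz]; rewrite b0 //.
  by apply: le_trans tz _; apply: ltW; near: z; exact: lt_nbhsl.
have int : lebesgue_measure.-integrable `[(-1 : R), x + 1] (EFin \o b).
  apply: continuous_compact_integrable; first exact: segment_compact.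
  exact: continuous_subspaceT.
have := @continuous_FTC1_closed R b (-1) x (x + 1).
rewrite ltrDl ltr01 => /(_ isT int) /(_ _ (cb x)) /wrap[].
  by apply: lt_le_trans x0; rewrite ltrN10.
by case=> d1; rewrite derive1E => d2; exact: (DeriveDef d1 d2).
Unshelve. all: by end_near. Qed.

(** Let b(x) = g(x) g(e - x), with g the flat function: a bump supported in
    [0, e].  A primitive F of b with F(0) = 0 is 0 on the left of 0 and a
    constant c > 0 on the right of e, so (F(x + a + e) - F(x + e)) / c is the
    plateau. *)
Lemma gevrey_plateau (p : nat) a e : (0 < p)%N -> 0 < e < a ->
  exists phi : nat -> R -> R,
  [/\ forall k x, is_derive x 1 (phi k) (phi k.+1 x),
      forall k x, ~~ (- (a + e) < x < 0) -> phi k x = 0,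
      forall k x, - a <= x <= - e -> phi k x = (k == 0%N)%:R
    & exists A D : R, [/\ 0 <= A, 0 <= D &
        forall k x, `|phi k x| ^+ p <= A * D ^+ k * k`!%:R ^+ p.+1]].
Proof.
move=> p0 /andP[e0 ea].
pose g := @gflat R p.
pose h i x := (-1) ^+ i * g i (e - x).
have dg i x : is_derive x 1 (g i) (g i.+1 x) by exact: is_derive_gflat.
have dh i x : is_derive x 1 (h i) (h i.+1 x).
  have d1 : is_derive x 1 (fun z : R => e - z) (- 1).
    by have := is_deriveB (is_derive_cst e x 1) (is_derive_id x 1);
        rewrite sub0r.
  have := is_derive_scal ((-1) ^+ i)
      (@is_derive_comp _ (g i) (fun z => e - z) x _ _ (dg i (e - x)) d1).
  by move=> H; apply: is_derive_eq H _; rewrite /h exprS; ring.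
pose b := leibniz g h.
have db k x : is_derive x 1 (b k) (b k.+1 x) by apply: is_derive_leibniz.
have cb : continuous (b 0%N) by move=> x; apply: is_derive_continuous (db _ _).
have b0 k x : x <= 0 -> b k x = 0.
  by move=> x0; rewrite /b /leibniz big1 // => i _;
      rewrite /g gflat_le0 // mul0r mulr0.
have be k x : e <= x -> b k x = 0.
  move=> x0; rewrite /b /leibniz big1 // => i _.
  have xe : e - x <= 0 by rewrite subr_le0.
  by rewrite /h /g (gflat_le0 _ _ xe) !mulr0.
have [F dF] := exists_primitive cb (b0 0%N).
(* The primitive that vanishes on the left of 0, with its derivatives. *)
pose psi k x := if k is k'.+1 then b k' x else F x - F 0.
have dpsi k x : is_derive x 1 (psi k) (psi k.+1 x).
  case: k => [|k]; last exact: db.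
  by have := is_deriveB (dF x) (is_derive_cst (F 0) x 1); rewrite subr0.
have constF x y : (forall z, Num.min x y < z < Num.max x y -> b 0%N z = 0) ->
    F y = F x.
  move=> Hz; apply/eqP; rewrite -subr_eq0 -normr_le0.
  have := @lipschitz_of_derive _ F (b 0%N) x y 0 dF; rewrite mul0r; apply.
  by move=> z /Hz ->; rewrite normr0.
pose c := F e - F 0.
have c0 : 0 < c.
  have [z] := mvt dF (negbT (lt_eqF e0)).
  rewrite min_l ?ltW// max_r ?ltW// => /andP[z0 ze] E.
  rewrite /c E subr0 mulr_gt0 // /b /leibniz big_ord1 /= mul1r mulr_gt0 //.
    exact: gflat0_gt0.
  by rewrite /h mul1r gflat0_gt0 // subr_gt0.
have psi_le0 k x : x <= 0 -> psi k x = 0.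
  case: k => [|k] x0 /=; last exact: b0.
  rewrite (@constF 0 x) ?subrr // => z.
  by rewrite max_l // => /andP[_ /ltW]; exact: b0.
have psi_gee k x : e <= x -> psi k x = (k == 0%N)%:R * c.
  case: k => [|k] x0 /=; last by rewrite be // mul0r.
  rewrite (@constF e x) ?mul1r // => z.
  by rewrite min_l // => /andP[/ltW ? _]; exact: be.
pose D : R := 2 ^+ p * ((8 * p.+1) ^ p * 2)%:R.
have D1 : 1 <= D.
  by rewrite /D -natrX -natrM ler1n !muln_gt0 !expn_gt0.
have D0 : 0 <= D by exact: le_trans D1.
have b_le k x : `|b k x| ^+ p <= D ^+ k * k`!%:R ^+ p.+1.
  apply: leibniz_le => // i; first exact: gflat_le.
  by rewrite /h normrM normrX normrN1 expr1n mul1r; exact: gflat_le.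
have b0_le x : `|b 0%N x| <= 1.
  by rewrite -(ler_root p0) // expr1n; apply: le_trans (b_le _ _) _;
      rewrite expr0 fact0 expr1n mul1r.
have psi0_le x : `|psi 0%N x| <= e.
  have L y : 0 <= y <= e -> `|F y - F 0| <= e.
    move=> /andP[y0 ye].
    apply: le_trans (lipschitz_of_derive dF (fun z _ => b0_le z)) _.
    by rewrite mul1r subr0 ger0_norm.
  have [x0|x0] := leP x 0; first by rewrite psi_le0 // normr0 ltW.
  have [xe|xe] := leP x e; first by apply: L; rewrite ltW.
  rewrite (psi_gee _ _ (ltW xe)) eqxx mul1r; apply: (L e).
  by rewrite lexx ltW.
have ep : 0 <= e ^+ p by rewrite exprn_ge0 // ltW.
have psi_le k x : `|psi k x| ^+ p <= (1 + e ^+ p) * D ^+ k * k`!%:R ^+ p.+1.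
  case: k => [|k].
    rewrite expr0 fact0 expr1n !mulr1; apply: le_trans (_ : e ^+ p <= _).
      by rewrite ler_root // ltW.
    by rewrite lerDr.
  apply: le_trans (b_le k x) _; rewrite -mulrA.
  apply: le_trans (_ : 1 * (D ^+ k.+1 * k.+1`!%:R ^+ p.+1) <= _); last first.
    by rewrite ler_wpM2r ?mulr_ge0 ?exprn_ge0// lerDl.
  rewrite mul1r ler_pM ?exprn_ge0//; first by rewrite ler_weXn2l.
  by rewrite lerXn2r ?nnegrE// ler_nat leq_fact.
exists (fun k x => (psi k (x + (a + e)) - psi k (x + e)) / c); split.
- move=> k x.
  have ds d : is_derive x 1 (fun z => psi k (z + d)) (psi k.+1 (x + d)).
    have := @is_derive_comp _ (psi k) (fun z => z + d) x _ _ (dpsi k (x + d))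
        (is_deriveD (is_derive_id x 1) (is_derive_cst d x 1)).
    by rewrite addr0 mulr1.
  have := is_derive_scal c^-1 (is_deriveB (ds (a + e)) (ds e)).
  rewrite [X in is_derive _ _ X](_ :
      _ = (fun x => (psi k (x + (a + e)) - psi k (x + e)) / c)); last first.
    by apply/funext => z; rewrite mulrC.
  by rewrite mulrC.
- move=> k x; rewrite negb_and -!leNgt => /orP[x0|x0].
    by rewrite !psi_le0 ?subrr ?mul0r//; move: ea e0; lra.
  by rewrite !psi_gee ?subrr ?mul0r//; move: ea e0 x0; lra.
- move=> k x /andP[x1 x2].
  rewrite psi_gee; last by move: x1; lra.
  have xe : x + e <= 0 by lra.
  by rewrite (psi_le0 _ _ xe) subr0 mulfK // gt_eqF.
exists ((2 / c) ^+ p * (1 + e ^+ p)), D; split => //.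
  by rewrite mulr_ge0 ?addr_ge0 // exprn_ge0 // divr_ge0 // ltW.
move=> k x.
have [mu mu0 muE] : exists2 mu : R,
    0 <= mu & mu ^+ p = (1 + e ^+ p) * D ^+ k * k`!%:R ^+ p.+1.
  apply: exists_root => //; apply: mulr_ge0; last exact: exprn_ge0.
  by apply: mulr_ge0; [exact: addr_ge0|exact: exprn_ge0].
have pm y : `|psi k y| <= mu by rewrite -(ler_root p0) // muE.
rewrite -!mulrA (mulrA (1 + _)) -muE -exprMn ler_root //; last first.
  by rewrite mulr_ge0 // divr_ge0 // ltW.
rewrite normrM normfV (gtr0_norm c0) mulrAC ler_wpM2r ?invr_ge0 ?(ltW c0)//.
apply: le_trans (ler_normB _ _) _.
by have := lerD (pm (x + (a + e))) (pm (x + e)); lra.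
Qed.

End Plateau.

(** * Exponential generating functions with function coefficients *)

Section ExpSeries.
Context {R : realType}.
Implicit Types (G : nat -> R -> R) (t s h r rho : R).

(** Uniformly in t, the coefficient G J t is at most of the order of J! / r^J,
    for every r: the series sum_J G J t s^J / J! then converges for all s. *)
Definition tame G := forall r, 0 < r ->
  exists M, forall J t, `|G J t| * r ^+ J <= M * J`!%:R.

Definition egf_partial G N t s := \sum_(J < N) G J t * (s ^+ J / J`!%:R).

Definition egf G t s := limn (fun N => egf_partial G N t s).

(** The lost factor J + 1 is recovered by using the bound for 2 r. *)
Lemma tame_shift G : tame G -> tame (fun J => G J.+1).
Proof.
move=> tG r r0.
have [M HM] := tG (2 * r) (mulr_gt0 (ltr0Sn _ _) r0).
exists (M / r) => J t.
have M0 : 0 <= M.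
  have := HM 0%N t; rewrite expr0 fact0 !mulr1; exact: le_trans.
rewrite mulrAC ler_pdivlMr// -mulrA -exprSr.
rewrite -(@ler_pM2r _ (2 ^+ J.+1)) ?exprn_gt0// -mulrA -exprMn (mulrC r).
apply: le_trans (HM J.+1 t) _; rewrite factS natrM -mulrA ler_wpM2l//.
rewrite mulrC ler_wpM2l // -natrX ler_nat.
by apply: ltnW; exact: ltn_expl.
Qed.

(** The bound for radius 2 rho turns into geometric decay on |s| <= rho. *)
Lemma tame_term G rho : tame G -> exists2 M : R, 0 <= M &
  forall J t s, `|s| <= rho -> `|G J t * (s ^+ J / J`!%:R)| <= M / 2 ^+ J.
Proof.
move=> tG; have [r0|r0] := leP rho 0.
  have [M HM] := tG 1 ltr01.
  have M0 : 0 <= M.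
    have := HM 0%N 0; rewrite expr0 fact0 !mulr1; exact: le_trans.
  exists M => // J t s /le_trans /(_ r0); rewrite normr_le0 => /eqP ->.
  case: J => [|J]; last by rewrite expr0n mul0r mulr0 normr0 divr_ge0
      ?exprn_ge0.
  by have := HM 0%N t; rewrite !expr0 fact0 !mulr1 !divr1 mulr1.
have [M HM] := tG (2 * rho) (mulr_gt0 (ltr0Sn _ _) r0).
have M0 : 0 <= M.
  have := HM 0%N 0; rewrite expr0 fact0 !mulr1; exact: le_trans.
exists M => // J t s sr.
rewrite normrM normrM normfV normr_nat mulrA ler_pdivrMr ?ltr0n ?fact_gt0//.
rewrite mulrAC ler_pdivlMr ?exprn_gt0// normrX -mulrA -exprMn.
apply: le_trans (HM J t); rewrite ler_wpM2l //
    lerXn2r ?nnegrE ?mulr_ge0 ?(ltW r0) //.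
by rewrite mulrC ler_wpM2l.
Qed.

Lemma sum_half_le N : \sum_(J < N) (2 ^+ J)^-1 <= 2 :> R.
Proof.
suff -> : \sum_(J < N) (2 ^+ J)^-1 = 2 - 2 / 2 ^+ N :> R.
  by rewrite gerBl divr_ge0 ?exprn_ge0.
elim: N => [|N IH]; first by rewrite big_ord0 expr0 divr1 subrr.
rewrite big_ord_recr /= IH exprS.
have : 2 ^+ N != 0 :> R by rewrite expf_neq0.
by move: (2 ^+ N) => x x0; field.
Qed.

Lemma egf_partial_bounded G rho : tame G -> exists2 M : R, 0 <= M &
  forall N t s, `|s| <= rho -> `|egf_partial G N t s| <= M.
Proof.
move=> /(tame_term rho) [M M0 HM]; exists (M * 2); first by rewrite mulr_ge0.
move=> N t s sr; apply: le_trans (ler_norm_sum _ _ _) _.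
apply: le_trans (ler_sum _ (fun (J : 'I_N) _ => HM J t s sr)) _.
by rewrite -mulr_sumr ler_wpM2l // sum_half_le.
Qed.

Lemma egf_partial_cvg G t s : tame G -> egf_partial G N t s @[N --> \oo] -->
    egf G t s.
Proof.
move=> /(tame_term `|s|) [M M0 HM].
rewrite /egf (_ : (fun N => egf_partial G N t s)
    = series (fun J => G J t * (s ^+ J / J`!%:R))); last first.
  by apply/funext => N; rewrite seriesEord.
apply: normed_cvg.
apply: (@series_le_cvg _ _ (geometric M 2^-1)).
- by move=> n; exact: normr_ge0.
- by move=> n; rewrite /geometric /= mulr_ge0 ?exprn_ge0 ?invr_ge0.
- by move=> n; rewrite /geometric /= exprVn; exact: HM.
- by apply: is_cvg_geometric_series;
    rewrite ger0_norm ?invr_ge0// invf_lt1 ?ltr1n.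
Qed.

Lemma egf_partial_cvgS G t s : tame G -> egf_partial G N.+1 t s @[N --> \oo] -->
    egf G t s.
Proof. by move=> tG; rewrite (cvg_shiftS (fun N => egf_partial G N t s));
    exact: egf_partial_cvg. Qed.

Lemma is_derive_egf_partial_coef G G1 N t s :
  (forall J (x : R), is_derive x 1 (G J) (G1 J x)) ->
  is_derive t 1 (fun x => egf_partial G N x s) (egf_partial G1 N t s).
Proof.
move=> dG; apply: is_derive_sum_fun => J.
move: (s ^+ J / J`!%:R) => c.
rewrite (_ : (fun y : R => G J y * c) = (fun y => c * G J y)); last first.
  by apply/funext => y; rewrite mulrC.
by rewrite mulrC; exact: is_derive_scal.
Qed.

Lemma is_derive_egf_partial_var G N t s :
  is_derive s 1 (fun x => egf_partial G N.+1 t x)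
      (egf_partial (fun J => G J.+1) N t s).
Proof.
rewrite /egf_partial (_ : (fun _ => _) =
   (fun x => G 0%N t + \sum_(J < N) G J.+1 t * (x ^+ J.+1 / J.+1`!%:R)));
       last first.
  by apply/funext => x; rewrite big_ord_recl expr0 fact0 divr1 mulr1.
have H : is_derive s 1 (fun x : R =>
    \sum_(J < N) G J.+1 t * (x ^+ J.+1 / J.+1`!%:R))
    (\sum_(J < N) G J.+1 t * (s ^+ J / J`!%:R)).
  apply: is_derive_sum_fun => J; apply: is_derive_scal.
  have H := is_derive_scal (J.+1`!%:R)^-1 (is_deriveX J.+1 (is_derive_id s 1)).
  rewrite (_ : (fun y => _) = (fun y : R => (J.+1`!%:R)^-1 * (id ^+ J.+1) y));
      last first.
    by apply/funext => y; rewrite mulrC exprfctE.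
  apply: is_derive_eq H _; rewrite /GRing.scale /= mulr1 factS natrM invfM.
  have J0 : J.+1%:R != 0 :> R by rewrite pnatr_eq0.
  by rewrite mulrC mulrACA mulfV // mul1r mulrC.
by have := is_deriveD (is_derive_cst (G 0%N t) s 1) H; rewrite add0r.
Qed.

(** Differentiation under the sum in the coefficients: the second order
    remainder of the partial sums is bounded uniformly in their length. *)
Lemma egf_coef_quadratic G G1 G2 t s :
  (forall J (x : R), is_derive x 1 (G J) (G1 J x)) ->
  (forall J (x : R), is_derive x 1 (G1 J) (G2 J x)) ->
  tame G -> tame G1 -> tame G2 ->
  exists C, forall h, `|h| <= 1 ->
    `|egf G (h + t) s - egf G t s - h * egf G1 t s| <= C * h ^+ 2.
Proof.
move=> dG dG1 tG tG1 tG2.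
have [C C0 HC] := egf_partial_bounded `|s| tG2.
exists C => h _.
have cv : `|egf_partial G N (h + t) s - egf_partial G N t s
    - h * egf_partial G1 N t s| @[N --> \oo] -->
   `|egf G (h + t) s - egf G t s - h * egf G1 t s|.
  apply: cvg_norm; apply: cvgB; first apply: cvgB; try exact: egf_partial_cvg.
  by apply: cvgM; [exact: cvg_cst|exact: egf_partial_cvg].
apply: cvgr_to_le cv _; near=> N.
apply: (@taylor2_of_derive _ (fun x => egf_partial G N x s)
    (fun x => egf_partial G1 N x s) (fun x => egf_partial G2 N x s)).
- by move=> z; exact: is_derive_egf_partial_coef.
- by move=> z; exact: is_derive_egf_partial_coef.
- by move=> z _; exact: HC.
Unshelve. all: by end_near. Qed.

(** The same in the variable s, where differentiation shifts the sequence. *)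
Lemma egf_var_quadratic G t s : tame G ->
  exists C, forall h, `|h| <= 1 ->
    `|egf G t (h + s) - egf G t s - h * egf (fun J => G J.+1) t s|
        <= C * h ^+ 2.
Proof.
move=> tG; have tG1 := tame_shift tG; have tG2 := tame_shift tG1.
have [C C0 HC] := egf_partial_bounded (`|s| + 1) tG2.
exists C => h h1.
(* Each derivative in the variable drops one term of the partial sum. *)
have cv : `|egf_partial G N.+2 t (h + s) - egf_partial G N.+2 t s
    - h * egf_partial (fun J => G J.+1) N.+1 t s| @[N --> \oo] -->
   `|egf G t (h + s) - egf G t s - h * egf (fun J => G J.+1) t s|.
  apply: cvg_norm; apply: cvgB; first apply: cvgB.
  - by rewrite (cvg_shiftS (fun N => egf_partial G N.+1 t (h + s)));
      exact: egf_partial_cvgS.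
  - by rewrite (cvg_shiftS (fun N => egf_partial G N.+1 t s));
      exact: egf_partial_cvgS.
  - by apply: cvgM; [exact: cvg_cst|exact: egf_partial_cvgS].
apply: cvgr_to_le cv _; near=> N.
apply: (@taylor2_of_derive _ (fun x => egf_partial G N.+2 t x)
   (fun x => egf_partial (fun J => G J.+1) N.+1 t x)
       (fun x => egf_partial (fun J => G J.+2) N t x)).
- by move=> z; exact: is_derive_egf_partial_var.
- by move=> z; exact: is_derive_egf_partial_var.
- move=> z /andP[z1 z2]; apply: HC.
  have := ler_norm h; have := ler_norm (- h); have := ler_norm s;
      have := ler_norm (- s).
  rewrite !normrN ler_norml => ? ? ? ?.
  by move: z1 z2; case: (ltP s (h + s)) => ? ? ?; apply/andP; split; lra.
Unshelve. all: by end_near. Qed.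

(** The partial derivatives are bounded on strips |s| <= rho, so the sum is
    Lipschitz there. *)
Lemma egf_lipschitz G G1 rho :
  (forall J (x : R), is_derive x 1 (G J) (G1 J x)) -> tame G -> tame G1 ->
  exists C, forall t t0 s s0, `|s| <= rho -> `|s0| <= rho ->
    `|egf G t s - egf G t0 s0| <= C * (`|t - t0| + `|s - s0|).
Proof.
move=> dG tG tG1; have tG' := tame_shift tG.
have [C C0 HC] := egf_partial_bounded rho tG1.
have [C' C0' HC'] := egf_partial_bounded rho tG'.
exists (C + C') => t t0 s s0 sr s0r.
have cv : `|egf_partial G N.+1 t s - egf_partial G N.+1 t0 s0| @[N --> \oo] -->
    `|egf G t s - egf G t0 s0|.
  by apply: cvg_norm; apply: cvgB; exact: egf_partial_cvgS.
apply: cvgr_to_le cv _; near=> N.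
have l1 : `|egf_partial G N.+1 t s - egf_partial G N.+1 t0 s| <= C * `|t - t0|.
  apply: (@lipschitz_of_derive _ (fun x => egf_partial G N.+1 x s)
      (fun x => egf_partial G1 N.+1 x s)).
    by move=> z; exact: is_derive_egf_partial_coef.
  by move=> z _; exact: HC.
have l2 : `|egf_partial G N.+1 t0 s - egf_partial G N.+1 t0 s0|
    <= C' * `|s - s0|.
  apply: (@lipschitz_of_derive _ (fun x => egf_partial G N.+1 t0 x)
      (fun x => egf_partial (fun J => G J.+1) N t0 x)).
    by move=> z; exact: is_derive_egf_partial_var.
  move=> z /andP[z1 z2]; apply: HC'.
  have [? ?] : s0 <= rho /\ - rho <= s0 by move: s0r;
      rewrite ler_norml => /andP[].
  have [? ?] : s <= rho /\ - rho <= s by move: sr; rewrite ler_norml => /andP[].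
  rewrite ler_norml; move: z1 z2.
  by case: (ltP s0 s) => ? ? ?; apply/andP; split; lra.
apply: le_trans (ler_distD (egf_partial G N.+1 t0 s) _ _) _.
apply: le_trans (lerD l1 l2) _.
have n1 : 0 <= C' * `|t - t0| by rewrite mulr_ge0.
have n2 : 0 <= C * `|s - s0| by rewrite mulr_ge0.
by rewrite mulrDl !mulrDr; lra.
Unshelve. all: by end_near. Qed.

Lemma egf_continuous (V : topologicalType) G G1 (f g : V -> R) :
  (forall J (x : R), is_derive x 1 (G J) (G1 J x)) -> tame G -> tame G1 ->
  continuous f -> continuous g -> continuous (fun x => egf G (f x) (g x)).
Proof.
move=> dG tG tG1 cf cg x.
have [C HC] := egf_lipschitz (`|g x| + 1) dG tG tG1.
have C0 : 0 <= C.
  have := HC 1 0 0 0; rewrite !normr0 => /(_ _ _)/wrap[||].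
  - by rewrite addr_ge0.
  - by rewrite addr_ge0.
  - by rewrite !subr0 normr1 normr0 addr0 mulr1; exact: le_trans.
apply/cvgrPdist_le => e e0.
have d0 : 0 < Num.min 1 (e / (2 * (C + 1))).
  by rewrite lt_min ltr01 divr_gt0 // mulr_gt0 // ltr_wpDl.
near=> y.
have fy : `|f x - f y| < Num.min 1 (e / (2 * (C + 1))).
  by near: y; apply: (cvgr_dist_lt _ _ (cf x)).
have gy : `|g x - g y| < Num.min 1 (e / (2 * (C + 1))).
  by near: y; apply: (cvgr_dist_lt _ _ (cg x)).
move: fy gy; rewrite !lt_min => /andP[_ fy] /andP[gy1 gy].
apply: le_trans (HC _ _ _ _ _ _) _; first by rewrite lerDl.
  have := ler_distD (g x) (g y) 0; rewrite !subr0 distrC => /le_trans; apply.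
  by rewrite addrC lerD2l ltW.
move: fy gy; rewrite !ltr_pdivlMr ?mulr_gt0 ?ltr_wpDl// => fy gy.
have := normr_ge0 (f x - f y); have := normr_ge0 (g x - g y).
by move: (`|f x - f y|) (`|g x - g y|) fy gy => u v fy gy u0 v0; nra.
Unshelve. all: by end_near. Qed.

End ExpSeries.

(** * Sequences of polynomials of subcritical growth *)

Section Factorials.

Lemma bin_le_exp2 n k : ('C(n, k) <= 2 ^ n)%N.
Proof.
have [kn|nk] := leqP k n; last by rewrite bin_small.
rewrite -[2%N]/(1 + 1)%N expnDn (bigD1 (Ordinal (kn : (k < n.+1)%N))) //=.
by rewrite !exp1n !muln1 leq_addr.
Qed.

Lemma fact_add_le i j : ((i + j)`! <= 2 ^ (i + j) * (i`! * j`!))%N.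
Proof.
have := bin_fact (leq_addr j i); rewrite addKn => <-.
by rewrite leq_mul2r bin_le_exp2 orbT.
Qed.

Lemma fact_add_ge i j : (i`! * j`! <= (i + j)`!)%N.
Proof.
have := bin_fact (leq_addr j i); rewrite addKn => <-.
by rewrite leq_pmull // bin_gt0 leq_addr.
Qed.

Lemma fact_mul_le k J : ((k * J)`! <= 2 ^ (k * k * J) * J`! ^ k)%N.
Proof.
elim: k => [|k IH]; first by rewrite !mul0n fact0 expn0.
rewrite mulSn; apply: leq_trans (fact_add_le _ _) _.
apply: leq_trans (leq_mul (leqnn _) (leq_mul (leqnn _) IH)) _.
rewrite expnS mulnCA [X in (_ <= X)%N]mulnCA leq_mul2l orbC mulnA leq_mul //.
by rewrite -expnD leq_exp2l //; nia.
Qed.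

Lemma expn_fact_le m z : (z`! ^ m <= (m * z)`!)%N.
Proof.
elim: m => [|m IH]; first by rewrite mul0n.
rewrite expnS mulSn; apply: leq_trans (fact_add_ge _ _).
by rewrite leq_mul2l IH orbT.
Qed.

Lemma mulnn_pred_succ m : (0 < m)%N -> (m * m = (m.-1 * m.+1).+1)%N.
Proof. by case: m => // k _; nia. Qed.

(** If z is about (m - 1) J / m, then (z!)^m is at most (m z)!, which is
    about ((m - 1) J)!, that is (J!)^(m - 1) up to geometric factors. *)
Lemma fact_exp_le m z J A : (m * z <= m.-1 * J + A)%N ->
  (z`! ^ m <= (2 ^ A * A`!) * (2 ^ (m.-1 + m.-1 * m.-1)) ^ J * J`! ^ m.-1)%N.
Proof.
move=> H; apply: leq_trans (expn_fact_le _ _) _.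
apply: leq_trans (leq_fact H) _.
apply: leq_trans (fact_add_le _ _) _.
apply: leq_trans (leq_mul (leqnn _) (leq_mul (fact_mul_le _ _) (leqnn _))) _.
rewrite -!expnM mulnDl !expnD leq_eqVlt; apply/orP; left; apply/eqP.
by move: (2 ^ (m.-1 * J))%N (2 ^ A)%N (2 ^ (m.-1 * m.-1 * J))%N (J`! ^ m.-1)%N
    (A`!) => *; ring.
Qed.

End Factorials.

Section PolyFamilies.
Context {R : realType}.
Local Notation C := R[i].
Local Notation Re := (@complex.Re R).
Local Notation Im := (@complex.Im R).
Implicit Types (p q : {poly C}) (b : nat -> {poly C}) (z w : C).

(** A submultiplicative norm with real values, equivalent to the modulus. *)
Definition norm1C (z : C) : R := `|Re z| + `|Im z|.

Lemma norm1C_ge0 z : 0 <= norm1C z. Proof. by rewrite addr_ge0. Qed.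

Lemma norm1C0 : norm1C 0 = 0. Proof. by rewrite /norm1C /= normr0 addr0. Qed.

Lemma norm1CD z w : norm1C (z + w) <= norm1C z + norm1C w.
Proof. by case: z w => [a b] [c d];
    rewrite /norm1C /= addrACA lerD ?ler_normD. Qed.

Lemma norm1CM z w : norm1C (z * w) <= norm1C z * norm1C w.
Proof.
case: z w => [a b] [c d]; rewrite /norm1C /=.
apply: le_trans (lerD (ler_normB _ _) (ler_normD _ _)) _.
rewrite !normrM mulrDl !mulrDr.
by rewrite le_eqVlt; apply/orP; left; apply/eqP; ring.
Qed.

(** Sums of all lengths are bounded, instead of the one of length size p, so
    that degrees need not be compared when polynomials are added. *)
Definition l1le p (K : R) := forall n, \sum_(l < n) norm1C p`_l <= K.

Lemma l1le0 K : 0 <= K -> l1le 0 K.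
Proof. by move=> K0 n; rewrite big1 // => i _; rewrite coef0 norm1C0. Qed.

Lemma l1le_ge0 p K : l1le p K -> 0 <= K.
Proof. by move=> /(_ 0%N); rewrite big_ord0. Qed.

Lemma l1leW p K K' : K <= K' -> l1le p K -> l1le p K'.
Proof. by move=> KK H n; exact: le_trans (H n) KK. Qed.

Lemma l1leD p q K L : l1le p K -> l1le q L -> l1le (p + q) (K + L).
Proof.
move=> Hp Hq n; apply: le_trans (lerD (Hp n) (Hq n)); rewrite -big_split /=.
by apply: ler_sum => i _; rewrite coefD norm1CD.
Qed.

Lemma l1le_sum n (F : 'I_n -> {poly C}) (K : 'I_n -> R) :
  (forall i, l1le (F i) (K i)) -> l1le (\sum_(i < n) F i) (\sum_(i < n) K i).
Proof.
move=> H; elim/big_rec2 : _ => [|i p K' _ IH]; first exact: l1le0.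
exact: l1leD.
Qed.

Lemma l1leZ z p K : l1le p K -> l1le (z *: p) (norm1C z * K).
Proof.
move=> H n; apply: le_trans (ler_wpM2l (norm1C_ge0 z) (H n)); rewrite mulr_sumr.
by apply: ler_sum => i _; rewrite coefZ norm1CM.
Qed.

Lemma l1leX p K : l1le p K -> l1le ('X * p) K.
Proof.
move=> H [|n]; first by rewrite big_ord0; exact: l1le_ge0 H.
rewrite big_ord_recl coefXM /= norm1C0 add0r.
by under eq_bigr do rewrite coefXM /=; exact: H.
Qed.

Lemma l1leC z : l1le z%:P (norm1C z).
Proof.
move=> [|n]; first by rewrite big_ord0 norm1C_ge0.
rewrite big_ord_recl coefC /= big1 ?addr0// => i _.
by rewrite coefC /= norm1C0.
Qed.

Lemma l1leM q p K : l1le p K -> l1le (q * p)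
    ((\sum_(i < size q) norm1C q`_i) * K).
Proof.
move=> H; rewrite -{1}[q]coefK poly_def mulr_suml mulr_suml.
apply: l1le_sum => i; rewrite -scalerAl; apply: l1leZ.
elim: (i : nat) => [|k IH]; first by rewrite mul1r.
by rewrite exprS -mulrA; exact: l1leX.
Qed.

End PolyFamilies.

Section Growth.
Context {R : realType} (m : nat) (m_gt0 : (0 < m)%N).
Local Notation C := R[i].
Local Notation Re := (@complex.Re R).
Local Notation Im := (@complex.Im R).
Implicit Types (p q : {poly C}) (b : nat -> {poly C}) (z w : C).

(** The growth of differential operators b J that a function of Gevrey order
    1 + 1/m tolerates when the results are divided by J! ([tame_jet_eval]). *)
Definition subcritical b := exists K A, 1 <= K /\
  forall J, (m * size (b J) <= m.-1 * J + A)%N /\ l1le (b J) (K ^+ J.+1 : R).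

Lemma subcritical0 : subcritical (fun=> 0).
Proof.
exists 1, 0%N; split=> // J; rewrite size_poly0 muln0; split=> //.
by rewrite expr1n; exact: l1le0.
Qed.

Lemma subcriticalX b : subcritical b -> subcritical (fun J => 'X * b J).
Proof.
move=> [K [A [K1 H]]]; exists K, (A + m)%N; split=> // J.
have [H1 H2] := H J; split; last exact: l1leX.
rewrite addnA; apply: leq_trans (_ : m * (size (b J)).+1 <= _)%N;
    last by rewrite mulnS addnC leq_add2r.
by rewrite leq_mul2l (leq_trans (size_polyMleq _ _)) ?orbT// size_polyX.
Qed.

Lemma subcritical_shift b : subcritical b -> subcritical (fun J => b J.+1).
Proof.
move=> [K [A [K1 H]]]; exists (K ^+ 2), (A + m.-1)%N; split;
    first exact: exprn_ege1.
move=> J; have [H1 H2] := H J.+1; split.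
  by apply: leq_trans H1 _; rewrite mulnS -addnA addnC addnA.
by apply: l1leW H2; rewrite -exprM ler_weXn2l //
    mulSn mul1n addSn ltnS leq_addl.
Qed.

Context (phi : nat -> R -> R) (A0 D0 : R).
Hypothesis dphi : forall k (x : R), is_derive x 1 (phi k) (phi k.+1 x).
Hypothesis A0_ge0 : 0 <= A0.
Hypothesis D0_ge0 : 0 <= D0.
Hypothesis phi_le : forall k x, `|phi k x| ^+ m
    <= A0 * D0 ^+ k * k`!%:R ^+ m.+1.

(** With phi l the l-th derivative of f, and rho the real or the imaginary
    part, this is the value at t of rho applied to p(d/dt) f. *)
Definition jet_eval (rho : C -> R) p (t : R) :=
    \sum_(l < size p) rho p`_l * phi l t.

Lemma jet_eval_widen (rho : C -> R) p t n : rho 0 = 0 -> (size p <= n)%N ->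
  jet_eval rho p t = \sum_(l < n) rho p`_l * phi l t.
Proof.
move=> rho0 sn; rewrite /jet_eval
    (big_ord_widen n (fun l => rho p`_l * phi l t)) // big_mkcond /=.
apply: eq_bigr => i _; case: ltnP => // /leq_sizeP -> //.
by rewrite rho0 mul0r.
Qed.

Lemma is_derive_jet_eval (rho : C -> R) p (t : R) : rho 0 = 0 ->
  is_derive t 1 (jet_eval rho p) (jet_eval rho ('X * p) t).
Proof.
move=> rho0.
rewrite (@jet_eval_widen _ _ _ (size p).+1) //; last first.
  by rewrite (leq_trans (size_polyMleq _ _)) // size_polyX.
rewrite big_ord_recl coefXM /= rho0 mul0r add0r.
under eq_bigr do rewrite coefXM /=.
by apply: is_derive_sum_fun => i; apply: is_derive_scal.
Qed.

(** Everything is raised to the power m^2.  For z = size (b J), the Gevrey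
    bound gives (z!)^((m + 1) m), and [fact_exp_le] turns it into
    (J!)^((m - 1)(m + 1)) = (J!)^(m^2 - 1) up to geometric factors.  One factor
    J! is spared, and it absorbs all the geometric ones. *)
Lemma tame_jet_eval (rho : C -> R) b : (forall z, `|rho z| <= norm1C z) ->
  subcritical b -> tame (fun J => jet_eval rho (b J)).
Proof.
move=> rho_le [K [A [K1 H]]] r r0.
have K0 : 0 <= K by exact: le_trans K1.
pose D := 1 + D0.
have D1 : 1 <= D by rewrite lerDl.
have D0' : 0 <= D by exact: le_trans D1.
(* After comparison of the factorials, what is left is Q q^J against J!, and
   q^J <= J! exp(q). *)
pose c1 : R := (2 ^ A * A`!)%:R ^+ m.+1.
pose c2 : R := (2 ^ (m.-1 + m.-1 * m.-1))%:R ^+ m.+1.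
pose Q := A0 ^+ m * K ^+ (m * m) * D ^+ A * c1.
pose q := K ^+ (m * m) * D ^+ m * c2 * r ^+ (m * m).
have Q0 : 0 <= Q by rewrite !mulr_ge0 ?exprn_ge0.
have q0 : 0 <= q by rewrite !mulr_ge0 ?exprn_ge0// ltW.
pose M := 1 + Q * expR q.
have M1 : 1 <= M by rewrite lerDl mulr_ge0 ?expR_ge0.
exists M => J t.
have [Hs Hl] := H J; set z := size (b J) in Hs.
have [mu mu0 muE] : exists2 mu : R,
    0 <= mu & mu ^+ m = A0 * D ^+ z * z`!%:R ^+ m.+1.
  apply: exists_root => //; by rewrite !mulr_ge0 ?exprn_ge0.
have phi_mu (l : 'I_z) : `|phi l t| <= mu.
  rewrite -(ler_root m_gt0) // muE; apply: le_trans (phi_le _ _) _.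
  have lz : (l <= z)%N by exact: ltnW.
  rewrite ler_pM ?mulr_ge0 ?exprn_ge0//.
    rewrite ler_wpM2l //; apply: le_trans (_ : D ^+ l <= _);
        last by rewrite ler_weXn2l.
    by rewrite lerXn2r ?nnegrE // lerDr.
  by rewrite lerXn2r ?nnegrE// ler_nat leq_fact.
have jet_eval_le : `|jet_eval rho (b J) t| <= K ^+ J.+1 * mu.
  apply: le_trans (ler_norm_sum _ _ _) _.
  apply: le_trans (ler_wpM2r mu0 (Hl z)); rewrite mulr_suml.
  by apply: ler_sum => l _; rewrite normrM; apply: ler_pM => //; exact: phi_mu.
apply: le_trans (ler_wpM2r (exprn_ge0 _ (ltW r0)) jet_eval_le) _.
have mm0 : (0 < m * m)%N by rewrite muln_gt0 m_gt0.
rewrite -(ler_root mm0); last 2 first.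
- by rewrite !mulr_ge0 ?exprn_ge0 // ltW.
- by rewrite mulr_ge0 // (le_trans _ M1).
rewrite [X in _ <= X]exprMn.
apply: le_trans (_ : M * J`!%:R ^+ (m * m) <= _); last first.
  rewrite ler_wpM2r ?exprn_ge0// -[X in X <= _]expr1 ler_weXn2l//.
have zf : z`!%:R ^+ m.+1 ^+ m <= c1 * c2 ^+ J * J`!%:R ^+ (m.-1 * m.+1) :> R.
  rewrite -exprM mulnC exprM (exprM _ m.-1) -[c2 ^+ J]exprM [(m.+1 * J)%N]mulnC
      [X in _ * X * _]exprM -!exprMn.
  rewrite lerXn2r ?nnegrE ?mulr_ge0 ?exprn_ge0//.
  by rewrite -!natrX -!natrM ler_nat; exact: fact_exp_le.
have DzA : (D ^+ z) ^+ m <= D ^+ A * (D ^+ m) ^+ J.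
  by rewrite -!exprM -exprD ler_weXn2l // mulnC (leq_trans Hs) //
      addnC leq_add2l leq_mul2r leq_pred orbT.
have big : (K ^+ J.+1 * mu * r ^+ J) ^+ (m * m)
    <= Q * q ^+ J * J`!%:R ^+ (m.-1 * m.+1).
  rewrite 2!exprMn [mu ^+ _]exprM muE 2!exprMn.
  have -> : (K ^+ J.+1) ^+ (m * m) = K ^+ (m * m) * (K ^+ (m * m)) ^+ J.
    by rewrite -!exprM -exprD mulSn mulnC.
  have -> : (r ^+ J) ^+ (m * m) = (r ^+ (m * m)) ^+ J by rewrite -!exprM mulnC.
  have h := ler_pM _ _ DzA zf.
  have {h} := h (exprn_ge0 _ (exprn_ge0 _ D0'))
      (exprn_ge0 _ (exprn_ge0 _ (ler0n _ _))).
  rewrite /Q /q !exprMn.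
  move: (K ^+ (m * m)) (K ^+ (m * m) ^+ J) (r ^+ (m * m) ^+ J)
    (exprn_ge0 (m * m) K0) (exprn_ge0 J (exprn_ge0 (m * m) K0))
    (exprn_ge0 J (exprn_ge0 (m * m) (ltW r0))) (exprn_ge0 m A0_ge0)
    => x1 x2 x3 x10 x20 x30 a0.
  move=> h; have y0 : 0 <= x1 * x2 * x3 * A0 ^+ m by rewrite !mulr_ge0.
  have := ler_wpM2l y0 h.
  move: (D ^+ z ^+ m) (z`!%:R ^+ m.+1 ^+ m) (D ^+ A) (D ^+ m ^+ J) (c2 ^+ J)
      (J`!%:R ^+ _) (A0 ^+ m) => y1 y2 y3 y4 y5 y6 y7.
  rewrite (_ : x1 * x2 * x3 * y7 * (y1 * y2) = x1 * x2 * (y7 * y1 * y2) * x3);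
      last by ring.
  move=> /le_trans; apply; rewrite le_eqVlt; apply/orP; left; apply/eqP; ring.
apply: le_trans big _.
have -> : J`!%:R ^+ (m * m) = J`!%:R * J`!%:R ^+ (m.-1 * m.+1) :> R.
  by rewrite -exprS -mulnn_pred_succ.
rewrite mulrA ler_wpM2r ?exprn_ge0//.
apply: le_trans (ler_wpM2l Q0 (exprn_le_fact_expR J q0)) _.
rewrite mulrCA mulrC ler_wpM2r //.
by rewrite /M lerDr.
Qed.

End Growth.

(** * Smooth functions from sequences of polynomials *)

Section Solution.
Context {R : realType} (n m : nat).
Local Notation C := R[i].
Local Notation Re := (@complex.Re R).
Local Notation Im := (@complex.Im R).
Context (phi : nat -> R -> R).
Hypothesis dphi : forall k (x : R), is_derive x 1 (phi k) (phi k.+1 x).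
Hypothesis tame_phi : forall (rho : C -> R) (b : nat -> {poly C}),
  (forall z, `|rho z| <= norm1C z) -> subcritical m b ->
  tame (fun J => jet_eval phi rho (b J)).
Implicit Types (b : nat -> {poly C}) (rho : C -> R) (x : 'rV[R]_n.+2)
    (i : 'I_n.+2).

Definition sol_part rho b x : R :=
  egf (fun J => jet_eval phi rho (b J)) (x ord0 ord0) (x ord0 ord_max).

(** The function sum_J (b_J(d/dt) f)(t) s^J / J! of t = x_1 and s = x_d, where
    phi k is the k-th derivative of f. *)
Definition sol b x : C := (sol_part Re b x +i* sol_part Im b x)%C.

(** The action of the i-th partial derivative on sequences of polynomials.
    The function sol b depends on the first and last coordinates alone, so the
    other partial derivatives give 0. *)
Definition shift_family i b : nat -> {poly C} :=
  if i == ord0 then fun J => 'X * b J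
  else if i == ord_max then fun J => b J.+1 else fun=> 0.

Lemma Re_le_norm1C z : `|Re z| <= norm1C z. Proof. by rewrite lerDl. Qed.
Lemma Im_le_norm1C z : `|Im z| <= norm1C z. Proof. by rewrite lerDr. Qed.

Lemma dominated_at0 rho : (forall z, `|rho z| <= norm1C z) -> rho 0 = 0.
Proof. by move=> /(_ 0); rewrite norm1C0 normr_le0 => /eqP. Qed.

Lemma subcritical_family i b : subcritical m b ->
    subcritical m (shift_family i b).
Proof.
move=> sb; rewrite /shift_family; case: ifP => _; first exact: subcriticalX.
by case: ifP => _; [exact: subcritical_shift|exact: subcritical0].
Qed.

Lemma sol_part0 rho x : rho 0 = 0 -> sol_part rho (fun=> 0) x = 0.
Proof.
move=> r0; rewrite /sol_part /egf (_ : (fun N => _) = (fun=> 0));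
    first exact: lim_cst.
apply/funext => N; rewrite /egf_partial big1 // => J _.
by rewrite /jet_eval size_poly0 big_ord0 mul0r.
Qed.

Lemma is_derive_sol_part rho b i x : (forall z, `|rho z| <= norm1C z) ->
  subcritical m b ->
  is_derive x (std_basis i) (sol_part rho b)
      (sol_part rho (shift_family i b) x).
Proof.
move=> hr sb; have r0 := dominated_at0 hr.
have sX := subcriticalX sb; have sXX := subcriticalX sX.
have coord h j : (h *: std_basis i + x) ord0 j = h * (j == i)%:R + x ord0 j.
  by rewrite !mxE eqxx.
have dev (p : nat -> {poly C}) J : forall t : R,
    is_derive t 1 (jet_eval phi rho (p J)) (jet_eval phi rho ('X * p J) t).
  by move=> t; exact: is_derive_jet_eval.
rewrite /shift_family; case: ifP => [/eqP i0|/negbT i0].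
  have [K HK] := egf_coef_quadratic (x ord0 ord0) (x ord0 ord_max) (dev b)
      (dev (fun J => 'X * b J))
    (tame_phi hr sb) (tame_phi hr sX) (tame_phi hr sXX).
  apply: (@is_derive_of_quadratic _ _ _ _ _ _ K) => h h1.
  by rewrite /sol_part !coord i0 eqxx /= mulr1 mulr0 add0r; exact: HK.
case: ifP => [/eqP im|/negbT im].
  have [K HK] := egf_var_quadratic (x ord0 ord0) (x ord0 ord_max)
      (tame_phi hr sb).
  apply: (@is_derive_of_quadratic _ _ _ _ _ _ K) => h h1.
  by rewrite /sol_part !coord im eqxx /= mulr1 mulr0 add0r; exact: HK.
rewrite sol_part0 //; apply: (@is_derive_of_quadratic _ _ _ _ _ _ 0) => h h1.
rewrite /sol_part !coord (eq_sym ord0) (eq_sym ord_max) (negbTE i0) (negbTE im).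
by rewrite !mulr0 !add0r !subrr normr0 mul0r.
Qed.

Lemma continuous_sol_part rho b : (forall z, `|rho z| <= norm1C z) ->
  subcritical m b -> continuous (sol_part rho b).
Proof.
move=> hr sb; have r0 := dominated_at0 hr.
apply: (@egf_continuous _ _ _ (fun J => jet_eval phi rho ('X * b J))).
- by move=> J t; exact: is_derive_jet_eval.
- exact: tame_phi.
- by apply: tame_phi => //; exact: subcriticalX.
- exact: coord_continuous.
- exact: coord_continuous.
Qed.

Lemma cpartial_sol i b : subcritical m b ->
  cpartial i (sol b) = sol (shift_family i b).
Proof.
move=> sb; apply/funext => x; rewrite /cpartial /sol.
have h1 := is_derive_sol_part i x Re_le_norm1C sb.
have h2 := is_derive_sol_part i x Im_le_norm1C sb.
by rewrite -(derive_val (is_derive := h1)) -(derive_val (is_derive := h2)).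
Qed.

Lemma cpartial_seq_sol s b : subcritical m b ->
  exists2 b', subcritical m b' & cpartial_seq s (sol b) = sol b'.
Proof.
move=> sb; elim: s => [|i s [b' sb' IH]]; first by exists b.
by exists (shift_family i b'); [exact:
    subcritical_family|rewrite /= -cpartial_sol // -IH].
Qed.

Lemma smooth_sol b : subcritical m b -> smooth (sol b).
Proof.
move=> sb s; have [b' sb' ->] := cpartial_seq_sol s sb.
split; [exact: (continuous_sol_part Re_le_norm1C)|exact:
    (continuous_sol_part Im_le_norm1C)|].
move=> i x; have h1 := is_derive_sol_part i x Re_le_norm1C sb'.
have h2 := is_derive_sol_part i x Im_le_norm1C sb'.
by split; [exact: (ex_derive (is_derive := h1))|exact:
    (ex_derive (is_derive := h2))].
Qed.

End Solution.

(** * The recursion solved by the coefficients *)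

Section Recursion.
Context {R : realType} (m : nat) (m_gt0 : (0 < m)%N).
Local Notation C := R[i].
Context (q : nat -> {poly C}) (c : C).
Hypothesis c_neq0 : c != 0.
Hypothesis q_m : q m = c%:P.
Hypothesis size_q : forall k, (k < m)%N -> (size (q k) <= m - k)%N.

Lemma recursion_root : exists mu : C, \sum_(j < m.+1) (q j)`_0 * mu ^+ j = 0.
Proof.
pose chi := \poly_(j < m.+1) (q j)`_0.
have sz : size chi = m.+1 by rewrite size_poly_eq // q_m coefC.
have : size chi != 1%R by rewrite sz eqSS -lt0n.
move=> /closed_rootP[mu]; rewrite /root => /eqP E; exists mu.
by move: E; rewrite horner_poly.
Qed.

Context (mu : C) (mu_root : \sum_(j < m.+1) (q j)`_0 * mu ^+ j = 0).

(** The window of m consecutive terms b J, ..., b (J + m - 1), indexed by k. *)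
Fixpoint rec_window J k : {poly C} :=
  if J is J'.+1 then
    if (k.+1 < m)%N then rec_window J' k.+1
    else (- c^-1) *: \sum_(i < m) q i * rec_window J' i
  else (mu ^+ k)%:P.

Definition rec_sol J := rec_window J 0.

Lemma rec_windowE k J : (k < m)%N -> rec_window J k = rec_sol (J + k).
Proof.
elim: k J => [|k IH] J km; first by rewrite addn0.
by rewrite addnS -addSn -IH 1?ltnW //= km.
Qed.

Lemma rec_solP J : \sum_(j < m.+1) q j * rec_sol (J + j) = 0.
Proof.
have E : rec_sol (J + m) = (- c^-1) *: \sum_(i < m) q i * rec_sol (J + i).
  have mm : (m.-1 < m)%N by rewrite prednK.
  rewrite (_ : J + m = J.+1 + m.-1)%N; last by rewrite addSn -addnS prednK.
  rewrite -rec_windowE //= prednK // ltnn; congr (_ *: _).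
  by apply: eq_bigr => i _; rewrite rec_windowE.
by rewrite big_ord_recr /= E q_m mul_polyC scalerA mulrN divff //
    scaleN1r subrr.
Qed.

(** The sequence mu^J satisfies the recursion obtained by evaluation at 0,
    because mu is a root of its characteristic polynomial. *)
Lemma rec_sol_coef0 J : (rec_sol J)`_0 = mu ^+ J.
Proof.
suff H k : (k < m)%N -> (rec_window J k)`_0 = mu ^+ (J + k) by rewrite H //
    addn0.
elim: J k => [|J IH] k km /=; first by rewrite coefC.
case: ltnP => [km1|mk]; first by rewrite IH // addnS.
have {mk} -> : k = m.-1 by apply/eqP;
    rewrite eqn_leq -ltnS prednK // km -ltnS prednK.
rewrite addSn -addnS prednK // coefZ coef_sum.
have := mu_root; rewrite big_ord_recr /= q_m coefC /= => /eqP;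
    rewrite addr_eq0 => /eqP E.
under eq_bigr => i _ do rewrite coef0M IH // exprD mulrCA.
by rewrite -mulr_sumr E exprD !(mulrN, mulNr) opprK mulrCA mulKf.
Qed.

(** The degree bound (m - 1) J / m + 1 is preserved: multiplication by
    q_i adds less than m - i to the degree while the index grows by m - i, and
    m (m - i) + (m - 1) i = m^2 - i <= m^2. *)
Lemma subcritical_rec_sol : subcritical m rec_sol.
Proof.
pose S := \sum_(i < m) \sum_(l < size (q i)) norm1C (q i)`_l.
have S0 : 0 <= S by apply: sumr_ge0 => i _; apply: sumr_ge0 => l _;
    exact: norm1C_ge0.
(* The summands serve K >= 1, the initial terms mu^k, and the recursion. *)
pose K := 1 + norm1C mu + norm1C (- c^-1) * S.
have cS : 0 <= norm1C (- c^-1) * S by rewrite mulr_ge0 ?norm1C_ge0.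
have K1 : 1 <= K by rewrite /K -addrA lerDl addr_ge0 ?norm1C_ge0.
have Kmu : norm1C mu <= K by rewrite /K addrAC lerDr addr_ge0.
have KS : norm1C (- c^-1) * S <= K by rewrite /K lerDr addr_ge0 ?norm1C_ge0.
have K0 : 0 <= K by exact: le_trans K1.
exists K, m; split=> // J.
suff H k : (k < m)%N -> (m * size (rec_window J k) <= m.-1 * (J + k) + m)%N /\
    l1le (rec_window J k) (K ^+ (J + k).+1).
  by have := H 0%N m_gt0; rewrite addn0.
elim: J k => [|J IH] k km /=.
  split; first by apply: leq_trans (leq_addl _ _);
      rewrite -{2}[m]muln1 leq_mul2l size_polyC_leq1 orbT.
  apply: l1leW (l1leC _); apply: le_trans (_ : K ^+ k <= _);
      last by rewrite ler_weXn2l.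
  elim: k {km} => [|k IHk]; first by rewrite /norm1C /= normr1 normr0 addr0.
  by rewrite !exprS; apply: le_trans (norm1CM _ _) _; apply: ler_pM;
      rewrite ?norm1C_ge0.
case: ltnP => [km1|mk]; first by rewrite addSnnS; exact: IH.
have {mk} -> : k = m.-1 by apply/eqP;
    rewrite eqn_leq -ltnS prednK // km -ltnS prednK.
rewrite addSn -addnS prednK //; split.
  have : (size ((- c^-1) *: \sum_(i < m) q i * rec_window J i)
      <= \max_(i < m) size (q i * rec_window J i)%R)%N.
    by apply: leq_trans (size_scale_leq _ _) (size_sum _ _ _).
  move=> /(leq_mul (leqnn m)) /leq_trans; apply.
  rewrite mulnC -leq_divRL //; apply/bigmax_leqP => i _;
      rewrite leq_divRL // mulnC.
  have [h1 _] := IH i (ltn_ord i); have h2 := size_q (ltn_ord i).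
  apply: leq_trans (leq_mul (leqnn m) (size_polyMleq _ _)) _.
  have h3 : (m * size (q i) <= m * (m - i))%N by rewrite leq_mul2l h2 orbT.
  have im := ltn_ord i.
  move: (size (q i)) (size (rec_window J i)) (i : nat) h1 h3 im m_gt0 => a b l;
      clear.
  case: m => // k /=.
  move=> h1 h3 ik _.
  by nia.
have KmJ : l1le (\sum_(i < m) q i * rec_window J i)
    (\sum_(i < m) (\sum_(l < size (q i)) norm1C (q i)`_l) * K ^+ (J + m)).
  apply: l1le_sum => i; apply: l1leM; have [_ h] := IH i (ltn_ord i).
  by apply: l1leW h; rewrite ler_weXn2l // ltn_add2l.
apply: l1leW (l1leZ _ KmJ); rewrite -mulr_suml mulrA exprS.
by rewrite ler_wpM2r // exprn_ge0.
Qed.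

End Recursion.

(** * The symbol in the plane of the first and last variables *)

Lemma big_seq_pred1 (V : nmodType) (T : eqType) (s : seq T) (x : T) (F : T -> V)
    :
  uniq s -> x \in s -> \sum_(i <- s | i == x) F i = F x.
Proof. by move=> us xs; rewrite -big_filter (filter_pred1_uniq us xs) big_seq1.
    Qed.

Section Symbol.
Context {R : realType} (n m : nat).
Local Notation C := R[i].
Implicit Types (P : {mpoly C[n.+2]}) (mu : 'X_{1..n.+2}) (k : 'I_n.+2).

(** The exponent of x_1^l x_d^j. *)
Definition mono1d (l j : nat) : 'X_{1..n.+2} :=
    (U_(ord0) *+ l + U_(ord_max) *+ j)%MM.

Lemma mono1dE l j k : mono1d l j k = (l * (k == ord0) + j * (k == ord_max))%N.
Proof. by rewrite /mono1d mnmDE !mulmnE !mnm1E mulnC [(_ * j)%N]mulnC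
    !(eq_sym _ k). Qed.

Lemma mdeg_mono1d l j : mdeg (mono1d l j) = (l + j)%N.
Proof. by rewrite /mono1d mdegD !mdegMn !mdeg1 !mul1n. Qed.

Definition planar mu := [forall k,
    (k == ord0) || (k == ord_max) || (mu k == 0%N)].

Lemma planarE mu : planar mu = (mu == mono1d (mu ord0) (mu ord_max)).
Proof.
apply/forallP/eqP => [H|-> k].
  apply/mnmP => k; rewrite mono1dE; have := H k.
  case: eqVneq => [->|_] /=; first by rewrite muln1 muln0 addn0.
  case: eqVneq => [->|_] /=; first by rewrite muln0 muln1.
  by rewrite !muln0 => /eqP.
by rewrite mono1dE; case: eqVneq => //= _; case: eqVneq => //= _;
    rewrite !muln0.
Qed.

(** On the k-th basis vector only the monomial x_k^m is nonzero. *)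
Lemma principal_part_basis P k : msize P = m.+1 ->
  (principal_part P).@[fun i => ((std_basis k : 'rV[R]_n.+2) ord0 i)%:C%C] =
  P@_(U_(k) *+ m)%MM.
Proof.
move=> sP; rewrite /principal_part sP /= pihomogE raddf_sum /=.
rewrite (eq_bigr (fun mu => if mu == (U_(k) *+ m)%MM then P@_mu else 0));
    last first.
  move=> mu /eqP dmu; rewrite mevalZ mevalX.
  case: eqVneq => [->|neq].
    rewrite big1 ?mulr1 // => i _; rewrite mulmnE mnm1E mxE eqxx /=.
    by rewrite (eq_sym i); case: (k == i); rewrite ?mul0n ?expr0 // expr1n.
  have [i /andP[ik mi]|H] := pickP (fun i => (i != k) && (mu i != 0%N));
      last first.
    have muE i : i != k -> mu i = 0%N.
      by move=> ik; have := H i; rewrite /= ik => /negbFE/eqP.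
    have muk : mu k = m.
      by rewrite -dmu mdegE (bigD1 k) //= big1 ?addn0 // => i; exact: muE.
    case/eqP: neq; apply/mnmP => i; rewrite mulmnE mnm1E;
        case: eqVneq => [<-|ki].
      by rewrite mul1n.
    by rewrite mul0n muE // eq_sym.
  by rewrite (bigD1 i) //= mxE eqxx /= (negbTE ik) expr0n (negbTE mi) mul0r
      mulr0.
rewrite -big_mkcondr /=.
have [h|h] := boolP ((U_(k) *+ m)%MM \in msupp P); last first.
  rewrite big1_seq; first by rewrite (memN_msupp_eq0 h).
  by move=> mu /andP[/andP[_ /eqP ->]] hh; rewrite hh in h.
rewrite (eq_bigl (pred1 (U_(k) *+ m)%MM)); last first.
  move=> mu /=; case: (eqVneq mu (U_(k) *+ m)%MM) => [->|_];
      last by rewrite andbF.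
  by rewrite mdegMn mdeg1 mul1n eqxx.
exact: big_seq_pred1 (msupp_uniq _) h.
Qed.

Lemma std_basis_neq0 k : std_basis k != 0 :> 'rV[R]_n.+2.
Proof.
apply/eqP => /matrixP /(_ ord0 k); rewrite !mxE !eqxx /= => /eqP.
by rewrite oner_eq0.
Qed.

Context (P : {mpoly C[n.+2]}) (Q : nat -> {mpoly C[n.+1]}).
Hypothesis degP : msize P = m.+1.
Hypothesis char_e1 : characteristic P (std_basis ord0).
Hypothesis nchar_ed : ~ characteristic P (std_basis ord_max).
Hypothesis P_eq : P = \sum_(j < m.+1) mwiden (Q j) * 'X_ord_max ^+ j.
Hypothesis degQ : forall k : nat, (k < m)%N ->
  (degree_in ord0 (Q k) < (Posz m - Posz k)%:E)%E.

Lemma coef_ed_neq0 : P@_(mono1d 0 m) != 0.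
Proof.
apply/eqP => E; apply: nchar_ed; split; first exact: std_basis_neq0.
by rewrite (principal_part_basis _ degP) -E /mono1d mulm0n add0m.
Qed.

(** Otherwise the principal part is constant, and e_1 and e_d are both
    characteristic or both not. *)
Lemma degree_gt0 : (0 < m)%N.
Proof.
rewrite lt0n; apply/negP => /eqP m0; have /negP := coef_ed_neq0; apply.
have [_] := char_e1; rewrite (principal_part_basis _ degP) m0 => E.
by rewrite -E /mono1d !mulm0n addm0.
Qed.

Lemma msupp_decomposition mu : mu \in msupp P -> exists j nu,
  [/\ (j <= m)%N, nu \in msupp (Q j) & mu
      = (mnmwiden nu + U_(ord_max) *+ j)%MM].
Proof.
rewrite P_eq => /msupp_sum_le /flatten_mapP[j _].
rewrite mpolyXn (perm_mem (msuppMX _ _)) => /mapP[nu' hnu ->].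
move: hnu; rewrite {1}(mpolyE (Q j)) raddf_sum /= =>
    /msupp_sum_le /flatten_mapP[nu].
rewrite mem_filter /= => hnu; rewrite mwidenZ mwidenX => /msuppZ_le.
rewrite msuppX inE => /eqP ->; exists j, nu; split=> //.
  by rewrite -ltnS.
by rewrite addmC.
Qed.

Lemma le_degree_in (i : 'I_n.+1) (q : {mpoly C[n.+1]}) nu : nu \in msupp q ->
  ((Posz (nu i))%:E <= degree_in i q)%E.
Proof.
move=> h; rewrite /degree_in.
elim: (msupp q : seq _) h => [//|x s IH].
rewrite inE big_cons le_max => /orP[/eqP ->|/IH ->]; first by rewrite lexx.
by rewrite orbT.
Qed.

(** The polynomials Q k do not involve x_d, so x_1^l x_d^j can only come from
    the summand of index j, where the degree in x_1 is bounded. *)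
Lemma mono1d_degree_lt l j : (j < m)%N -> P@_(mono1d l j) != 0 -> (l < m - j)%N.
Proof.
rewrite -mcoeff_msupp => jm /msupp_decomposition[j' [nu [jm' hnu E]]].
have w0 : widen_ord (leqnSn n.+1) ord0 = ord0 by apply: val_inj.
have Ej : j = j'.
  move/mnmP/(_ ord_max): E; rewrite mono1dE mnmDE mnmwiden_ordmax mulmnE mnm1E
      eqxx /=.
  by rewrite muln0 muln1 mul1n.
have El : l = nu ord0.
  move/mnmP/(_ ord0): E; rewrite mono1dE mnmDE -w0 mnmwiden_widen mulmnE mnm1E
      w0 /=.
  by rewrite muln0 muln1 mul0n !addn0.
subst j' l; have := le_lt_trans (le_degree_in ord0 hnu) (degQ jm).
by rewrite lte_fin; clear -jm; lia.
Qed.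

(** The polynomial q_j: the coefficient of (d/ds)^j in P(D) acting on functions
    of t = x_1 and s = x_d, as a polynomial in d/dt. *)
Definition symbol j : {poly C} :=
  \poly_(l < m.+1) (P@_(mono1d l j) * (- 'i%C) ^+ (l + j)).

Lemma size_symbol j : (j < m)%N -> (size (symbol j) <= m - j)%N.
Proof.
move=> jm; apply/leq_sizeP => l lj; rewrite coef_poly; case: ifP => // _.
have /negbNE/eqP -> := contra_leqN (mono1d_degree_lt jm) lj.
by rewrite mul0r.
Qed.

(** A monomial x_1^l x_d^m with l > 0 has degree larger than m. *)
Lemma symbol_m : symbol m = (P@_(mono1d 0 m) * (- 'i%C) ^+ m)%:P.
Proof.
apply/polyP => l; rewrite coef_poly coefC; case: l => [|l] //=;
    case: ifP => // _.
rewrite memN_msupp_eq0 ?mul0r //; apply/negP => /msize_mdeg_lt.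
by rewrite mdeg_mono1d degP ltnS addSn ltnNge leq_addl.
Qed.

Lemma symbol_m_neq0 : P@_(mono1d 0 m) * (- 'i%C) ^+ m != 0.
Proof.
rewrite mulf_neq0 ?coef_ed_neq0 // expf_neq0 // oppr_eq0 eq_complex /=.
by rewrite oner_eq0 andbF.
Qed.

(** The sum over the exponents of P that involve only x_1 and x_d becomes a
    double sum over the square of side m + 1, which contains them because P has
    degree m. *)
Lemma sum_planar (V : zmodType) (F : nat -> nat -> C -> V) :
  (forall l j, F l j 0 = 0) ->
  \sum_(mu <- msupp P | planar mu) F (mu ord0) (mu ord_max) P@_mu =
  \sum_(j < m.+1) \sum_(l < m.+1) F l j P@_(mono1d l j).
Proof.
move=> F0; rewrite pair_big /=.
transitivity (\sum_(mu <- msupp P) \sum_(p : 'I_m.+1 * 'I_m.+1)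
    if mono1d p.2 p.1 == mu then F p.2 p.1 P@_mu else 0).
  rewrite big_mkcond /=; apply: eq_big_seq => mu hmu.
  have mub k : (mu k < m.+1)%N.
    rewrite ltnS; have := msize_mdeg_lt hmu;
        rewrite degP ltnS => /(leq_trans _); apply.
    by rewrite mdegE (bigD1 k) //= leq_addr.
  case: ifP => [|/negP np].
    rewrite planarE => /eqP E.
    rewrite (bigD1 (Ordinal (mub ord_max), Ordinal (mub ord0))) //= -E eqxx big1
        ?addr0 //.
    move=> [j l] /eqP jl; case: eqP => // El; case: jl.
    congr pair; apply: val_inj; rewrite /= -El mono1dE /=.
      by rewrite eqxx muln0 muln1.
    by rewrite muln0 muln1 addn0.
  rewrite big1 // => p _; case: eqP => // El; case: np.
  rewrite planarE -El; apply/eqP; congr mono1d; rewrite mono1dE /=.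
    by rewrite muln0 muln1 addn0.
  by rewrite eqxx muln0 muln1.
rewrite exchange_big /=; apply: eq_bigr => -[j l] _ /=.
rewrite -big_mkcond /=.
have [h|h] := boolP (mono1d l j \in msupp P); last first.
  rewrite big1_seq; first by rewrite (memN_msupp_eq0 h) F0.
  by move=> mu /andP[/eqP <-] hh; rewrite hh in h.
under eq_bigl do rewrite eq_sym.
exact: big_seq_pred1 (msupp_uniq _) h.
Qed.

End Symbol.

(** * Reduction of the equation to the recursion *)

Section Equation.
Context {R : realType} (n m : nat).
Local Notation C := R[i].
Local Notation Re := (@complex.Re R).
Local Notation Im := (@complex.Im R).
Implicit Types (b : nat -> {poly C}) (x : 'rV[R]_n.+2) (i : 'I_n.+2) (c : C).

Lemma subcriticalD b b' : subcritical m b -> subcritical m b' ->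
  subcritical m (fun J => b J + b' J).
Proof.
move=> [K [A [K1 H]]] [K' [A' [K1' H']]]; exists (K + K'), (A + A')%N.
have K0 : 0 <= K by exact: le_trans K1.
have K0' : 0 <= K' by exact: le_trans K1'.
split=> [|J]; first by apply: le_trans K1 _; rewrite lerDl.
have [s1 l1] := H J; have [s2 l2] := H' J; split.
  apply: leq_trans (leq_mul (leqnn m) (size_polyD _ _)) _.
  rewrite maxnMr geq_max; apply/andP; split;
      first by rewrite addnA (leq_trans s1) // leq_addr.
  by rewrite addnCA (leq_trans s2) // leq_addl.
apply: l1leW (l1leD l1 l2); rewrite !exprS mulrDl.
by apply: lerD; rewrite ler_wpM2l // lerXn2r ?nnegrE ?addr_ge0 // ?lerDl ?lerDr.
Qed.

Lemma subcriticalZ c b : subcritical m b -> subcritical m (fun J => c *: b J).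
Proof.
move=> [K [A [K1 H]]]; exists ((1 + norm1C c) * K), A.
have c1 : 1 <= 1 + norm1C c by rewrite lerDl norm1C_ge0.
split=> [|J]; first by rewrite mulr_ege1.
have [s1 l1] := H J; split.
  by apply: leq_trans s1; rewrite leq_mul2l size_scale_leq orbT.
apply: l1leW (l1leZ c l1); rewrite exprMn ler_wpM2r ?exprn_ge0 ?(le_trans _ K1)
    //.
apply: le_trans (_ : 1 + norm1C c <= _); first by rewrite lerDr.
by rewrite -[X in X <= _]expr1 ler_weXn2l.
Qed.

Context (phi : nat -> R -> R).
Hypothesis dphi : forall k (x : R), is_derive x 1 (phi k) (phi k.+1 x).
Hypothesis tame_phi : forall (rho : C -> R) b,
  (forall z, `|rho z| <= norm1C z) -> subcritical m b ->
  tame (fun J => jet_eval phi rho (b J)).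

Lemma jet_evalD (rho : C -> R) p q t : rho 0 = 0 -> {morph rho : z w / z + w} ->
  jet_eval phi rho (p + q) t = jet_eval phi rho p t + jet_eval phi rho q t.
Proof.
move=> r0 rD; have s1 := size_polyD p q.
rewrite (jet_eval_widen _ _ r0 s1)
    (jet_eval_widen _ _ r0 (leq_maxl (size p) (size q))).
rewrite (jet_eval_widen _ _ r0 (leq_maxr (size p) (size q))) -big_split /=.
by apply: eq_bigr => l _; rewrite coefD rD mulrDl.
Qed.

(** Multiplication by a complex constant mixes the real and imaginary parts,
    which is why linearity of sol is derived from [sol_part_linear], where the
    three functionals may differ. *)
Lemma jet_eval_ReZ c p t :
  jet_eval phi Re (c *: p) t = complex.Re c * jet_eval phi Re p t
      - complex.Im c * jet_eval phi Im p t.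
Proof.
rewrite (@jet_eval_widen _ _ _ _ _ (size p)) ?size_scale_leq //.
rewrite /jet_eval !mulr_sumr -sumrB; apply: eq_bigr => l _.
rewrite coefZ; case: c p`_l => [a b] [d e] /=; ring.
Qed.

Lemma jet_eval_ImZ c p t :
  jet_eval phi Im (c *: p) t = complex.Re c * jet_eval phi Im p t
      + complex.Im c * jet_eval phi Re p t.
Proof.
rewrite (@jet_eval_widen _ _ _ _ _ (size p)) ?size_scale_leq //.
rewrite /jet_eval !mulr_sumr -big_split; apply: eq_bigr => l _.
rewrite coefZ; case: c p`_l => [a b] [d e] /=; ring.
Qed.

Lemma ReD : {morph Re : z w / z + w}. Proof. by case=> [? ?] []. Qed.
Lemma ImD : {morph Im : z w / z + w}. Proof. by case=> [? ?] []. Qed.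

Lemma sol_part_linear (rho1 rho2 rho3 : C -> R) (r2 r3 : R) b1 b2 b3 x :
  (forall z, `|rho2 z| <= norm1C z) -> (forall z, `|rho3 z| <= norm1C z) ->
  subcritical m b2 -> subcritical m b3 ->
  (forall J t, jet_eval phi rho1 (b1 J) t
      = r2 * jet_eval phi rho2 (b2 J) t + r3 * jet_eval phi rho3 (b3 J) t) ->
  sol_part phi rho1 b1 x = r2 * sol_part phi rho2 b2 x
      + r3 * sol_part phi rho3 b3 x.
Proof.
move=> h2 h3 s2 s3 H; rewrite /sol_part {1}/egf.
apply/cvg_lim => //.
rewrite (_ : (fun N => _) = (fun N =>
    r2 * egf_partial (fun J => jet_eval phi rho2 (b2 J)) N (x ord0 ord0)
    (x ord0 ord_max)
   + r3 * egf_partial (fun J => jet_eval phi rho3 (b3 J)) N (x ord0 ord0)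
       (x ord0 ord_max))).
  by apply: cvgD; apply: cvgM; try exact: cvg_cst; apply: egf_partial_cvg;
      exact: tame_phi.
apply/funext => N; rewrite /egf_partial !mulr_sumr -big_split;
    apply: eq_bigr => J _ /=.
by rewrite H mulrDl !mulrA.
Qed.

Lemma solD b b' x : subcritical m b -> subcritical m b' ->
  sol phi (fun J => b J + b' J) x = sol phi b x + sol phi b' x.
Proof.
move=> sb sb'; rewrite /sol.
rewrite (@sol_part_linear Re Re Re 1 1 _ b b') //;
    [|exact: Re_le_norm1C|exact: Re_le_norm1C|]; last first.
  by move=> J t; rewrite jet_evalD ?mul1r //; exact: ReD.
rewrite (@sol_part_linear Im Im Im 1 1 _ b b') //;
    [|exact: Im_le_norm1C|exact: Im_le_norm1C|]; last first.
  by move=> J t; rewrite jet_evalD ?mul1r //; exact: ImD.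
by rewrite !mul1r.
Qed.

Lemma solZ c b x : subcritical m b ->
  sol phi (fun J => c *: b J) x = c * sol phi b x.
Proof.
move=> sb; rewrite /sol.
rewrite (@sol_part_linear Re Re Im (Re c) (- Im c) (fun J => c *: b J) b b) //;
    [|exact: Re_le_norm1C|exact: Im_le_norm1C|]; last first.
  by move=> J t; rewrite jet_eval_ReZ mulNr.
rewrite (@sol_part_linear Im Im Re (Re c) (Im c) (fun J => c *: b J) b b) //;
    [|exact: Im_le_norm1C|exact: Re_le_norm1C|]; last first.
  by move=> J t; rewrite jet_eval_ImZ.
by case: c => [c1 c2] /=; rewrite mulNr.
Qed.

Lemma sol0 x : sol phi (fun=> 0) x = 0.
Proof. by rewrite /sol !sol_part0. Qed.

Lemma sol_sum (I : Type) (s : seq I) (c : I -> C) (bb : I -> nat -> {poly C}) x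
    :
  (forall k : I, subcritical m (bb k)) ->
  \sum_(i <- s) c i * sol phi (bb i) x
      = sol phi (fun J => \sum_(i <- s) c i *: bb i J) x.
Proof.
move=> H.
suff [] : \sum_(i <- s) c i * sol phi (bb i) x
    = sol phi (fun J => \sum_(i <- s) c i *: bb i J) x
   /\ subcritical m (fun J => \sum_(i <- s) c i *: bb i J) by [].
elim: s => [|i s [IH1 IH2]].
  rewrite big_nil (_ : (fun J => _) = (fun=> 0)); last by apply/funext => J;
      rewrite big_nil.
  by rewrite sol0; split=> //; exact: subcritical0.
rewrite big_cons (_ : (fun J => _)
    = (fun J => c i *: bb i J + \sum_(i <- s) c i *: bb i J)); last first.
  by apply/funext => J; rewrite big_cons.
have sZ := subcriticalZ (c i) (H i).
by split; [rewrite (solD _ sZ IH2) solZ // IH1|exact: subcriticalD].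
Qed.

Lemma iter_shift_family i k b J : iter k (shift_family i) b J =
  if i == ord0 then 'X^k * b J
  else if i == ord_max then b (J + k)%N else if k == 0%N then b J else 0.
Proof.
elim: k J => [|k IH] J /=.
  by rewrite mul1r addn0; case: ifP => // _; case: ifP.
rewrite {1}/shift_family; case: eqP IH => [_|_] IH.
  by rewrite IH mulrA -exprS.
by case: eqP IH => [_|_] IH //; rewrite IH addSnnS.
Qed.

Definition iterated_family (mu : 'X_{1..n.+2}) s b :=
  foldr (fun i => iter (mu i) (shift_family i)) b s.

(** One variable other than the first and the last one with a positive
    exponent annihilates the sequence; the remaining derivatives multiply by a
    power of X and shift. *)
Lemma iterated_familyE mu s b J : uniq s -> iterated_family mu s b J =
  if all (fun i => (i == ord0) || (i == ord_max) || (mu i == 0%N)) s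
  then 'X^((ord0 \in s) * mu ord0) * b (J + (ord_max \in s) * mu ord_max)%N
  else 0.
Proof.
elim: s J => [|i s IH] J /=; first by rewrite !mul0n addn0 mul1r.
move=> /andP[ns us]; rewrite iter_shift_family.
have [i0|i0] := eqVneq i ord0.
  rewrite /= IH // inE i0 eqxx mul1n; case: ifP => _; last by rewrite mulr0.
  move: ns; rewrite i0 => /negbTE ->; rewrite mul0n mul1r.
  by rewrite inE (_ : ord_max == ord0 = false).
have [im|im] := eqVneq i ord_max.
  rewrite /= IH // inE im; case: ifP => _ //.
  move: ns; rewrite im => /negbTE ->; rewrite mul0n addn0 inE eqxx mul1n.
  by rewrite (_ : ord0 == ord_max = false).
rewrite /= !inE (eq_sym ord0) (eq_sym ord_max) (negbTE i0) (negbTE im) /=.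
by case: (mu i == 0%N) => //=; rewrite IH.
Qed.

Lemma subcritical_iterated mu s b : subcritical m b ->
    subcritical m (iterated_family mu s b).
Proof.
move=> sb; elim: s => [|i s IH] //=; elim: (mu i) => [|k IHk] //=.
exact: subcritical_family.
Qed.

Lemma cpartial_multi_sol mu b : subcritical m b ->
  cpartial_multi mu (sol phi b) = sol phi (iterated_family mu (enum 'I_n.+2) b).
Proof.
move=> sb; rewrite /cpartial_multi; elim: (enum _) => [|i s IH] //=.
rewrite IH; have := subcritical_iterated mu s sb;
    move: (iterated_family mu s b) => b'.
elim: (mu i) => [|k IHk] sb' //=; rewrite IHk //.
rewrite (cpartial_sol dphi tame_phi) //.
by elim: k {IHk} => [|k IHk] //=; exact: subcritical_family.
Qed.

Lemma iterated_family_enum mu b J : iterated_family mu (enum 'I_n.+2) b J =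
  if planar mu then 'X^(mu ord0) * b (J + mu ord_max)%N else 0.
Proof.
rewrite iterated_familyE ?enum_uniq // !mem_enum !mul1n.
congr (if _ then _ else _); apply/allP/forallP => H i; first by apply: H;
    rewrite mem_enum.
by move=> _; exact: H.
Qed.

Lemma diff_op_sol (P : {mpoly C[n.+2]}) b x : msize P = m.+1 ->
    subcritical m b ->
  (forall J, \sum_(j < m.+1) symbol m P j * b (J + j)%N = 0) ->
  diff_op P (sol phi b) x = 0.
Proof.
move=> degP sb rec; rewrite /diff_op.
under eq_bigr do rewrite cpartial_multi_sol //.
rewrite (sol_sum _ _ _ (fun mu => subcritical_iterated mu _ sb)).
rewrite -[RHS](sol0 x); congr sol; apply/funext => J.
rewrite -[RHS](rec J).
pose F l j (c : C) := (c * (- 'i%C) ^+ (l + j)%N) *: ('X^l * b (J + j)%N).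
transitivity (\sum_(mu <- msupp P | planar mu) F (mu ord0) (mu ord_max) P@_mu).
  rewrite [RHS]big_mkcond /=; apply: eq_bigr => mu _.
  rewrite iterated_family_enum /F; case: ifP => [|_]; last by rewrite scaler0.
  by rewrite planarE => /eqP {2}->; rewrite mdeg_mono1d.
rewrite (sum_planar degP); last by move=> l j; rewrite /F mul0r scale0r.
apply: eq_bigr => j _; rewrite /symbol poly_def mulr_suml.
by apply: eq_bigr => l _; rewrite /F scalerAl.
Qed.

End Equation.

(** * The complex exponential series *)

Section ComplexExp.
Context {R : realType} (mu : R[i]).
Local Notation C := R[i].
Local Notation Re := (@complex.Re R).
Local Notation Im := (@complex.Im R).
Implicit Types (z w : C) (s h : R) (rho : C -> R).

(** The functional rho applied to z exp(mu s), as a real series. *)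
Definition exp_part rho z s := egf (fun J _ => rho (z * mu ^+ J)) 0 s.

Definition cexp s : C := (exp_part Re 1 s +i* exp_part Im 1 s)%C.

Lemma tame_geometric rho z : (forall w, `|rho w| <= norm1C w) ->
  tame (fun J _ => rho (z * mu ^+ J)).
Proof.
move=> hr r r0; exists (norm1C z * expR (norm1C mu * r)) => J _.
have powle : norm1C (z * mu ^+ J) <= norm1C z * norm1C mu ^+ J.
  elim: J => [|J IH]; first by rewrite !mulr1.
  rewrite !exprSr !mulrA; apply: le_trans (norm1CM _ _) _.
  by rewrite ler_wpM2r ?norm1C_ge0.
have r0' := ltW r0.
apply: le_trans (ler_wpM2r (exprn_ge0 _ r0') (le_trans (hr _) powle)) _.
rewrite -!mulrA ler_wpM2l ?norm1C_ge0// -exprMn [X in _ <= X]mulrC.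
by apply: exprn_le_fact_expR; rewrite mulr_ge0 ?norm1C_ge0.
Qed.

Lemma exp_part_linear rho1 rho2 rho3 z r2 r3 s :
  (forall w, `|rho2 w| <= norm1C w) -> (forall w, `|rho3 w| <= norm1C w) ->
  (forall w, rho1 (z * w) = r2 * rho2 w + r3 * rho3 w) ->
  exp_part rho1 z s = r2 * exp_part rho2 1 s + r3 * exp_part rho3 1 s.
Proof.
move=> h2 h3 H; rewrite {1}/exp_part /egf; apply/cvg_lim => //.
rewrite (_ : (fun N => _) = (fun N =>
    r2 * egf_partial (fun J _ => rho2 (1 * mu ^+ J)) N 0 s
   + r3 * egf_partial (fun J _ => rho3 (1 * mu ^+ J)) N 0 s)).
  by apply: cvgD; apply: cvgM; try exact: cvg_cst; apply: egf_partial_cvg;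
      exact: tame_geometric.
apply/funext => N; rewrite /egf_partial !mulr_sumr -big_split;
    apply: eq_bigr => J _ /=.
by rewrite H mulrDl !mulrA !mul1r.
Qed.

Lemma exp_part_Re z s : exp_part Re z s = complex.Re (z * cexp s).
Proof.
rewrite (@exp_part_linear Re Re Im z (Re z) (- Im z));
    [|exact: Re_le_norm1C|exact: Im_le_norm1C|].
  by case: z => a b /=; rewrite mulNr.
by case: z => a b [c d] /=; rewrite mulNr.
Qed.

Lemma exp_part_Im z s : exp_part Im z s = complex.Im (z * cexp s).
Proof.
rewrite (@exp_part_linear Im Im Re z (Re z) (Im z));
    [|exact: Im_le_norm1C|exact: Re_le_norm1C|].
  by case: z => a b.
by case: z => a b [c d].
Qed.

Lemma is_derive_exp_part rho s : (forall w, `|rho w| <= norm1C w) ->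
  is_derive s 1 (exp_part rho 1) (exp_part rho mu s).
Proof.
move=> hr; have [K HK] := egf_var_quadratic 0 s (tame_geometric 1 hr).
apply: (@is_derive_of_quadratic _ _ _ _ _ _ K) => h h1.
rewrite /GRing.scale /= mulr1 /exp_part.
rewrite (_ : (fun J _ => rho (mu * mu ^+ J))
    = (fun J (_ : R) => rho (1 * mu ^+ J.+1))).
  exact: HK.
by apply/funext => J; rewrite mul1r exprS.
Qed.

Lemma cexp0 : cexp 0 = 1.
Proof.
have H rho : exp_part rho 1 0 = rho 1.
  rewrite /exp_part /egf; apply/cvg_lim => //; rewrite -cvg_shiftS.
  rewrite (_ : (fun N => _) = (fun=> rho 1)); first exact: cvg_cst.
  apply/funext => N; rewrite /egf_partial big_ord_recl /= !expr0 fact0 divr1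
      !mulr1 big1 ?addr0//.
  by move=> i _; rewrite expr0n mul0r mulr0.
by rewrite /cexp !H.
Qed.

(** As a function of h the left-hand side has derivative 0, because the
    derivative of the exponential is mu times itself. *)
Lemma cexp_mulN s h : cexp (h + s) * cexp (- h) = cexp s.
Proof.
pose e1 : R -> R := exp_part Re 1; pose e2 : R -> R := exp_part Im 1.
have d1 (t : R) : is_derive t 1 e1 (Re mu * e1 t - Im mu * e2 t).
  have := is_derive_exp_part t Re_le_norm1C; rewrite exp_part_Re.
  by case: (mu).
have d2 (t : R) : is_derive t 1 e2 (Re mu * e2 t + Im mu * e1 t).
  have := is_derive_exp_part t Im_le_norm1C; rewrite exp_part_Im.
  by case: (mu).
have dS (f : R -> R) (df t : R) : is_derive (t + s) 1 f df ->
    is_derive t 1 (fun y => f (y + s)) df.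
  move=> df'.
  have := @is_derive_comp _ f (fun y => y + s) t _ _ df'
      (is_deriveD (is_derive_id t 1) (is_derive_cst s t 1)).
  by rewrite addr0 mulr1.
have dN (f : R -> R) (df t : R) : is_derive (- t) 1 f df ->
    is_derive t 1 (fun y => f (- y)) (- df).
  move=> df'.
  have := @is_derive_comp _ f (fun y => - y) t _ _ df'
      (is_deriveN (is_derive_id t 1)).
  by rewrite mulrN1.
(* The real and imaginary parts of exp(mu (t + s)) exp(- mu t). *)
pose D1 t := e1 (t + s) * e1 (- t) - e2 (t + s) * e2 (- t).
pose D2 t := e1 (t + s) * e2 (- t) + e2 (t + s) * e1 (- t).
have D10 (t : R) : is_derive t 1 D1 0.
  have := is_deriveB (is_derive_mul (dS _ _ _ (d1 (t + s)))
      (dN _ _ _ (d1 (- t))))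
     (is_derive_mul (dS _ _ _ (d2 (t + s))) (dN _ _ _ (d2 (- t)))).
  by move=> H; apply: is_derive_eq H _; ring.
have D20 (t : R) : is_derive t 1 D2 0.
  have := is_deriveD (is_derive_mul (dS _ _ _ (d1 (t + s)))
      (dN _ _ _ (d2 (- t))))
     (is_derive_mul (dS _ _ _ (d2 (t + s))) (dN _ _ _ (d1 (- t)))).
  by move=> H; apply: is_derive_eq H _; ring.
have E1 := const_of_derive0 h 0 D10; have E2 := const_of_derive0 h 0 D20.
have [z1 z2] : e1 0 = 1 /\ e2 0 = 0 by case: cexp0.
rewrite /D1 /D2 oppr0 add0r z1 z2 !mulr0 mulr1 subr0 in E1.
rewrite /D1 /D2 oppr0 add0r z1 z2 !mulr0 mulr1 add0r in E2.
have -> : cexp s = (e1 s +i* e2 s)%C by [].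
by rewrite -E1 -E2.
Qed.

Lemma cexpD s h : cexp (h + s) = cexp s * cexp h.
Proof.
have hh : cexp h * cexp (- h) = 1 by have := cexp_mulN 0 h; rewrite addr0 cexp0.
by rewrite -(cexp_mulN s h) mulrAC -mulrA hh mulr1.
Qed.

Lemma cexp_neq0 s : cexp s != 0.
Proof.
apply/eqP => E; have := cexp_mulN 0 s; rewrite addr0 E mul0r cexp0 => /esym/eqP.
by rewrite oner_eq0.
Qed.

End ComplexExp.

Section UnconditionalSum.
Context {R : realType} (I : choiceType) (iota : nat -> I) (kappa : I -> nat).
Hypothesis iotaK : cancel iota kappa.

(** Geometric decay gives convergence along all finite sets, for a family
    supported on the image of an injective sequence iota: once a finite set
    contains iota 0, ..., iota (N - 1), what it adds to these is bounded by the
    tail. *)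
Lemma partial_sum_cvg (F : I -> R) (M l : R) :
  (forall i, i != iota (kappa i) -> F i = 0) ->
  (forall k, `|F (iota k)| <= M / 2 ^+ k) ->
  \sum_(k < N) F (iota k) @[N --> \oo] --> l ->
  summability.partial_sum F A @[A --> summability.totally] --> l.
Proof.
have FF := @summability.totally_filter I.
move=> F0 FM cv; apply/cvgrPdist_le => e e0.
have M0 : 0 <= M by have := FM 0%N; rewrite expr0 divr1; exact: le_trans.
have e2 : 0 < e / 2 by rewrite divr_gt0.
have tail : \forall N \near \oo, 2 * M / 2 ^+ N <= e / 2.
  have : 2 * M * (2^-1) ^+ N @[N --> \oo] --> (2 * M * 0 : R).
    apply: cvgM; first exact: cvg_cst.
    by apply: cvg_expr; rewrite ger0_norm ?invr_ge0// invf_lt1 ?ltr1n.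
  move=> /cvgrPdist_le /(_ _ e2); apply: filterS => N.
  rewrite mulr0 sub0r normrN ger0_norm ?exprVn //.
  by rewrite -exprVn !mulr_ge0 ?exprn_ge0 ?invr_ge0.
have main : \forall N \near \oo, `|l - \sum_(k < N) F (iota k)| <= e / 2.
  by move/cvgrPdist_le : cv => /(_ _ e2).
have [N [tN mN]] : exists N, 2 * M / 2 ^+ N
    <= e / 2 /\ `|l - \sum_(k < N) F (iota k)| <= e / 2.
  exact: (filter_ex (filterI tail main)).
exists [fset iota (nat_of_ord k) | k : 'I_N]%fset => //= A sA.
have inA k : (k < N)%N -> iota k \in A.
  move=> kN; apply: (fsubsetP sA); by apply/imfsetP; exists (Ordinal kN).
(* A bound on the indices k such that iota k belongs to A. *)
pose K := (\max_(i <- A) (kappa i).+1 + N)%N.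
have NK : (N <= K)%N by rewrite leq_addl.
have AK i : i \in A -> (kappa i < K)%N.
  move=> iA; apply: leq_trans (leq_addr _ _).
  exact: (@leq_bigmax_seq _ _ xpredT (fun i => (kappa i).+1)).
have -> : summability.partial_sum F A
    = \sum_(k < K) if iota k \in A then F (iota k) else 0.
  rewrite /summability.partial_sum -(big_seq_fsetE _ _ xpredT F) /=.
  transitivity (\sum_(i <- A) \sum_(k < K) if i == iota k then F i else 0).
    apply: eq_big_seq => i iA; case: (eqVneq i (iota (kappa i))) => [E|ni].
      rewrite (bigD1 (Ordinal (AK i iA))) //= -E eqxx big1 ?addr0 // => k nk.
      case: eqP => // Ek; case/eqP: nk; apply: val_inj.
      by rewrite /= Ek iotaK.
    by rewrite F0 // big1 // => k _; case: ifP.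
  rewrite exchange_big /=; apply: eq_bigr => k _; rewrite -big_mkcond /=.
  have [h|h] := boolP (iota k \in A);
      first exact: big_seq_pred1 (fset_uniq _) h.
  by rewrite big1_seq // => i /andP[/eqP ->]; rewrite (negbTE h).
rewrite -(subnKC NK) big_split_ord /=.
rewrite [X in l - (X + _)](eq_bigr (fun k : 'I_N => F (iota k)));
    last by move=> k _; rewrite inA.
rewrite opprD addrA; apply: le_trans (ler_normB _ _) _.
rewrite [X in _ <= X](splitr e); apply: lerD => //.
apply: le_trans (ler_norm_sum _ _ _) _.
apply: le_trans (_ : \sum_(k < K - N) (M / 2 ^+ N) * (2 ^+ k)^-1 <= _).
  apply: ler_sum => k _; case: ifP => _.
    by apply: le_trans (FM _) _; rewrite exprD invfM mulrA.
  by rewrite normr0 !mulr_ge0 ?invr_ge0 ?exprn_ge0.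
rewrite -mulr_sumr; apply: le_trans (ler_wpM2l _ (sum_half_le _)) _.
  by rewrite mulr_ge0 ?invr_ge0 ?exprn_ge0.
by apply: le_trans tN; rewrite mulrC mulrA.
Qed.

End UnconditionalSum.

(** * Behaviour outside and on the plateau *)

Section OnPlateau.
Context {R : realType} (n : nat) (phi : nat -> R -> R).
Local Notation C := R[i].
Local Notation Re := (@complex.Re R).
Local Notation Im := (@complex.Im R).
Implicit Types (x : 'rV[R]_n.+2) (b : nat -> {poly C}) (mu z : C).

Lemma sol_outside b x : (forall k, phi k (x ord0 ord0) = 0) -> sol phi b x = 0.
Proof.
move=> H; suff E rho : sol_part phi rho b x = 0 by rewrite /sol !E.
rewrite /sol_part /egf (_ : (fun N => _) = (fun=> 0)); first exact: lim_cst.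
apply/funext => N; rewrite /egf_partial big1 // => J _.
by rewrite /jet_eval big1 ?mul0r // => l _; rewrite H mulr0.
Qed.

(** At a point where f is 1 and its derivatives vanish, p(d/dt) f is p(0). *)
Lemma sol_plateau b mu x : (forall k, phi k (x ord0 ord0) = (k == 0%N)%:R) ->
  (forall J, (b J)`_0 = mu ^+ J) -> sol phi b x = cexp mu (x ord0 ord_max).
Proof.
move=> H bE.
have E rho : rho 0 = 0 -> sol_part phi rho b x
    = exp_part mu rho 1 (x ord0 ord_max).
  move=> r0; rewrite /sol_part /exp_part /egf; congr (limn _);
      apply/funext => N.
  apply: eq_bigr => J _; congr (_ * _).
  rewrite (@jet_eval_widen _ _ _ _ _ (size (b J)).+1) //
      big_ord_recl /= H eqxx mulr1 bE mul1r.
  by rewrite big1 ?addr0 // => l _; rewrite H /= mulr0.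
by rewrite /sol !E.
Qed.

Lemma partial_sum_morph (I : choiceType) (rho : C -> R) (f : I -> C) A :
  rho 0 = 0 -> {morph rho : z w / z + w} ->
  rho (summability.partial_sum f A) = summability.partial_sum (rho \o f) A.
Proof. by move=> r0 rD; rewrite /summability.partial_sum (big_morph rho rD r0).
    Qed.

(** The power series of z exp(mu h) in h, read as a power series in all the
    variables with only powers of the last one. *)
Lemma sums_to_exp_last (f : 'X_{1..n.+2} -> C) mu z (h : R) :
  (forall nu : 'X_{1..n.+2}, nu != mono1d n 0 (nu ord_max) -> f nu = 0) ->
  (forall k, f (mono1d n 0 k) = z * mu ^+ k * (h ^+ k / k`!%:R)%:C%C) ->
  sums_to f (z * cexp mu h).
Proof.
move=> f0 fE.
have iotaK : cancel (mono1d n 0) (fun nu : 'X_{1..n.+2} => nu ord_max).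
  by move=> k; rewrite mono1dE eqxx muln1.
suff H rho : (forall w, `|rho w| <= norm1C w) -> {morph rho : z w / z + w} ->
    (forall w (r : R), rho (w * r%:C%C) = rho w * r) ->
    rho (summability.partial_sum f A) @[A --> summability.totally] -->
        exp_part mu rho z h.
  split.
    rewrite -exp_part_Re; apply: H; [exact: Re_le_norm1C|exact: ReD|].
    by move=> [p q] r /=; rewrite mulr0 subr0.
  rewrite -exp_part_Im; apply: H; [exact: Im_le_norm1C|exact: ImD|].
  by move=> [p q] r /=; rewrite mulr0 add0r.
move=> hr rD rr; have r0 := dominated_at0 hr.
rewrite (_ : (fun A => _) = summability.partial_sum (rho \o f)); last first.
  by apply/funext => A; exact: partial_sum_morph.
have tG := tame_geometric mu z hr.
have [M _ HM] := tame_term `|h| tG.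
have fE' k : (rho \o f) (mono1d n 0 k) = rho (z * mu ^+ k) * (h ^+ k / k`!%:R).
  by rewrite /= fE rr.
apply: (partial_sum_cvg iotaK (M := M)).
- by move=> nu /f0 /= ->.
- by move=> k; rewrite fE'; exact: (HM k 0 h).
rewrite (_ : (fun N => _) = (fun N =>
    egf_partial (fun J _ => rho (z * mu ^+ J)) N 0 h)).
  exact: egf_partial_cvg.
by apply/funext => N; apply: eq_bigr => k _; exact: fE'.
Qed.

(** At x0 the expansion in h = s - s0 has the coefficients
    exp(mu s0) mu^k / k!, by the functional equation of the exponential. *)
Lemma real_analytic_cexp (Omega : set 'rV[R]_n.+2) (u : 'rV[R]_n.+2 -> C) mu :
  open Omega -> (forall x, Omega x -> u x = cexp mu (x ord0 ord_max)) ->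
  real_analytic_on Omega u.
Proof.
move=> oO uE x0 Ox0; pose z := cexp mu (x0 ord0 ord_max).
exists (fun nu : 'X_{1..n.+2} => if nu == mono1d n 0 (nu ord_max)
  then z * mu ^+ nu ord_max * ((nu ord_max)`!%:R^-1)%:C%C else 0).
near=> x.
have Ox : Omega x by near: x; exact: open_nbhs_nbhs.
rewrite uE // -(subrK (x0 ord0 ord_max) (x ord0 ord_max)) cexpD -/z.
apply: sums_to_exp_last => [nu /negbTE -> |k]; first by rewrite mul0r.
have -> : mono1d n 0 k ord_max = k by rewrite mono1dE eqxx muln1.
rewrite eqxx (bigD1 ord_max) //= big1 ?mulr1; last first.
  by move=> i im; rewrite mono1dE (negbTE im) muln0.
rewrite mono1dE eqxx muln1 add0n !mxE -!mulrA; do 2 congr (_ * _).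
by rewrite mulrC rmorphM /= rmorphXn.
Unshelve. all: by end_near. Qed.

End OnPlateau.

(** * The solution *)

(* The dimension d >= 2 is n.+2; x_1 is the variable of index ord0 and x_d the
   one of index ord_max; mwiden embeds polynomials in x_1, ..., x_(d-1) into
   polynomials in x_1, ..., x_d. *)
Theorem theorem5 (R : realType) (n m : nat) (P : {mpoly R[i][n.+2]})
    (Q : nat -> {mpoly R[i][n.+1]})
    (degP : msize P = m.+1)
    (char_e1 : characteristic P (std_basis ord0))
    (nchar_ed : ~ characteristic P (std_basis ord_max))
    (P_eq : P = \sum_(j < m.+1) mwiden (Q j) * 'X_ord_max ^+ j)
    (degQ : forall k : nat, (k < m)%N ->
       (degree_in ord0 (Q k) < (Posz m - Posz k)%:E)%E) :
  forall a : R, 0 < a -> forall eps : R, 0 < eps < a ->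
  exists u : 'rV[R]_n.+2 -> R[i],
    [/\ smooth u,
        forall x, diff_op P u x = 0,
        [set x : 'rV[R]_n.+2 | - a <= x ord0 ord0 <= - eps] `<=` supp u,
        supp u `<=` [set x : 'rV[R]_n.+2 | - (a + eps) <= x ord0 ord0 <= 0] &
        real_analytic_on
          [set x : 'rV[R]_n.+2 | - a < x ord0 ord0 < - eps] u].
Proof.
move=> a a0 eps epsa.
have m_gt0 := degree_gt0 degP char_e1 nchar_ed.
have c0 := symbol_m_neq0 degP nchar_ed.
have qm := symbol_m degP.
have sq j (jm : (j < m)%N) := size_symbol P_eq degQ jm.
have [mu mu_root] := recursion_root m_gt0 c0 qm.
have [phi [dphi phi_out phi_in [A [D [A0 D0 phi_le]]]]] :=
    gevrey_plateau m_gt0 epsa.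
have tame_phi rho b (hr : forall z, `|rho z| <= norm1C z) (sb : subcritical m b)
    :=
  tame_jet_eval m_gt0 A0 D0 phi_le hr sb.
pose b := rec_sol m (symbol m P) (P@_(mono1d n 0 m) * (- 'i%C) ^+ m) mu.
have sb : subcritical m b by exact: subcritical_rec_sol.
have b0 J : (b J)`_0 = mu ^+ J by exact: rec_sol_coef0.
have uin (x : 'rV[R]_n.+2) : - a <= x ord0 ord0 <= - eps ->
    sol phi b x = cexp mu (x ord0 ord_max).
  by move=> hx; apply: sol_plateau => // k; exact: phi_in.
have cont : continuous (fun x : 'rV[R]_n.+2 => x ord0 ord0).
  exact: coord_continuous.
exists (sol phi b); split.
- exact: (smooth_sol dphi tame_phi).
- move=> x; apply: (diff_op_sol dphi tame_phi) => // J.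
  exact: rec_solP.
- by move=> x /= hx; apply: subset_closure; rewrite /= uin // cexp_neq0.
- have -> : [set x : 'rV[R]_n.+2 | - (a + eps) <= x ord0 ord0 <= 0] =
     (fun x : 'rV[R]_n.+2 => x ord0 ord0) @^-1` `[- (a + eps), 0].
    by apply/seteqP; split=> x /=; rewrite in_itv.
  have cl : closed ((fun x : 'rV[R]_n.+2 => x ord0 ord0) @^-1`
      `[- (a + eps), 0]).
    by apply: closed_comp => //; exact: itv_closed.
  rewrite [X in _ `<=` X](closure_id _).1 //; apply: closure_subset => x /= ux.
  rewrite in_itv /=; apply: contraNT ux => hx; apply/eqP.
  apply: sol_outside => k; apply: phi_out; apply: contra hx => /andP[h1 h2].
  by rewrite !ltW.
apply: (real_analytic_cexp (mu := mu)).
  have -> : [set x : 'rV[R]_n.+2 | - a < x ord0 ord0 < - eps] =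
     (fun x : 'rV[R]_n.+2 => x ord0 ord0) @^-1` `]- a, - eps[.
    by apply/seteqP; split=> x /=; rewrite in_itv.
  by apply: open_comp => //; exact: itv_open.
by move=> x /= /andP[h1 h2]; apply: uin; rewrite !ltW.
Qed.
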